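(* Suppose there exists an integer $d\ge 3$ such that for every integer $p\ge1$ there exists $k_0(d,p)$ such that for every $k\ge k_0(d,p)$ there exists a $p$-shuffle chain on $\mathcal{C}_k^{(d)}$ whose stationary distribution is the uniform distribution on $\mathcal{C}_k^{(d)}$. Then the Jacobian conjecture holds: for every $n\ge1$, every Keller map $F:\mathbb{C}^n\to\mathbb{C}^n$ is a polynomial automorphism.
   Context: For $d\ge2$, a $d$-Catalan tree is a rooted planar tree in which every vertex has $0$ or $d$ children (internal vertices have $d$); $\mathcal{C}_k^{(d)}$ is the set of such trees with $k$ internal vertices. The height of a vertex is its graph distance to the root. A path of length $p$ is $(v_0,\dots,v_p)$ with $v_i$ a child of $v_{i-1}$; every vertex $v$ of height $\ge p$ is the endpoint $v_p$ of a unique such path. For $1\le i\le p$ the $d-1$ siblings of $v_i$ subtend subtrees (sibling plus descendants); the shuffle class $\mathrm{Sh}_{T,p}(v)\subseteq\mathcal{C}_k^{(d)}$ is the set of trees obtained from $T$ by rearranging these $(d-1)p$ subtrees among the $(d-1)p$ sibling positions, all else fixed. A $p$-shuffle chain on $\mathcal{C}_k^{(d)}$ is specified by a family $\{P_T: T\in\mathcal{C}_k^{(d)}\}$ where $P_T$ is a probability measure on the vertex set $V(T)$ with $P_T(v)>0$ iff $v$ has height at least $p$; it is the Markov chain on $\mathcal{C}_k^{(d)}$ with transition probabilities $\mathbb{P}(T_{j+1}=T'\mid T_j=T)=\sum_{v\in V(T)}P_T(v)\,\mathbf{1}\{T'\in\mathrm{Sh}_{T,p}(v)\}/\#\mathrm{Sh}_{T,p}(v)$.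 A polynomial mapping $F:\mathbb{C}^n\to\mathbb{C}^n$ is a Keller map if $\det JF$ is a nonzero constant, and a polynomial automorphism if it has a polynomial two-sided compositional inverse. *)

(* Defs.v *)
From mathcomp Require Import all_boot all_algebra.
From mathcomp Require Import mpoly.
From mathcomp Require Import complex.
From mathcomp Require Import Rstruct.
Set Implicit Arguments. Unset Strict Implicit. Unset Printing Implicit Defensive.
Import GRing.Theory.
Local Open Scope ring_scope.

Definition Real : rcfType := Rdefinitions.R.
Definition Cplx : fieldType := Real[i].

(* Rooted planar trees.  We use the countable tree type of choice.v: an     *)
(* internal vertex with ordered children s is  GenTree.Node 0 s , a leaf is *)
(* GenTree.Leaf tt.  (Nodes with a label <> 0 are excluded by is_dcat.)    *)
Definition ptree := GenTree.tree unit.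
Definition leaf : ptree := GenTree.Leaf tt.

Definition children (t : ptree) : seq ptree :=
  if t is GenTree.Node _ s then s else [::].

Fixpoint is_dcat (d : nat) (t : ptree) : bool :=
  match t with
  | GenTree.Leaf _ => true
  | GenTree.Node n s => [&& n == 0%N, size s == d & all (is_dcat d) s]
  end.

Fixpoint internal (t : ptree) : nat :=
  match t with
  | GenTree.Leaf _ => 0
  | GenTree.Node _ s => (sumn (map internal s)).+1
  end.

Definition catalan (d k : nat) (t : ptree) : bool :=
  is_dcat d t && (internal t == k).

(* Vertices are addressed by their path from the root: the address of a    *)
(* vertex is the sequence of child indices (0-based, left to right).  The  *)
(* height of the vertex with address a is size a.                          *)
Fixpoint vertices (t : ptree) : seq (seq nat) :=
  match t with
  | GenTree.Leaf _ => [:: [::]]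
  | GenTree.Node _ s =>
      [::] :: (fix aux (i : nat) (s : seq ptree) : seq (seq nat) :=
                 match s with
                 | [::] => [::]
                 | c :: s' => map (cons i) (vertices c) ++ aux i.+1 s'
                 end) 0%N s
  end.

Fixpoint subtree (t : ptree) (a : seq nat) : ptree :=
  match a with
  | [::] => t
  | i :: a' => subtree (nth leaf (children t) i) a'
  end.

Fixpoint replace (t : ptree) (a : seq nat) (u : ptree) : ptree :=
  match a with
  | [::] => u
  | i :: a' =>
      match t with
      | GenTree.Leaf _ => t
      | GenTree.Node n s => GenTree.Node n (set_nth leaf s i (replace (nth leaf s i) a' u))
      end
  end.

(* graft the subtrees l = [:: (a1,u1); ...] at the (pairwise disjoint)     *)
(* addresses a1, a2, ...                                                   *)
Definition graft (t : ptree) (l : seq (seq nat * ptree)) : ptree :=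
  foldl (fun t' qu => replace t' qu.1 qu.2) t l.

(* For the vertex v = v_p of address a (height h = size a >= p), with path *)
(* (v_0,...,v_p), v_{i} = take (h-p+i) a: the sibling positions of         *)
(* v_1,...,v_p, i.e. the (d-1)p addresses  rcons (take m a) j  for          *)
(* m = h-p,...,h-1 and j < d, j <> (index of v_{m-h+p+1} among the         *)
(* children of v_{m-h+p}) = nth 0 a m.                                     *)
Definition sibling_positions (d p : nat) (a : seq nat) : seq (seq nat) :=
  flatten [seq [seq rcons (take m a) j | j <- iota 0 d & j != nth 0%N a m]
          | m <- iota (size a - p) p].

Definition shuffle_class (d p : nat) (T : ptree) (a : seq nat) : seq ptree :=
  let pos := sibling_positions d p a in
  undup [seq graft T (zip pos ts) | ts <- permutations (map (subtree T) pos)].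

Definition shuffle_transition (d p : nat) (P : ptree -> seq nat -> Real)
    (T T' : ptree) : Real :=
  \sum_(v <- vertices T)
     P T v * (T' \in shuffle_class d p T v)%:R / (size (shuffle_class d p T v))%:R.

Definition shuffle_chain_family (d p k : nat) (P : ptree -> seq nat -> Real) : Prop :=
  forall T, catalan d k T ->
    (forall v, v \in vertices T -> 0 <= P T v /\ (0 < P T v <-> (p <= size v)%N))
    /\ \sum_(v <- vertices T) P T v = 1.

Definition uniform_stationary (d p k : nat) (P : ptree -> seq nat -> Real) : Prop :=
  forall s : seq ptree, uniq s -> (forall T, (T \in s) = catalan d k T) ->
    forall T', T' \in s ->
      \sum_(T <- s) (size s)%:R^-1 * shuffle_transition d p P T T' = (size s)%:R^-1.

Definition jacobian (n : nat) (F : 'I_n -> {mpoly Cplx[n]}) : 'M[{mpoly Cplx[n]}]_n :=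
  \matrix_(i < n, j < n) mderiv j (F i).

Definition keller_map (n : nat) (F : 'I_n -> {mpoly Cplx[n]}) : Prop :=
  exists c : Cplx, c != 0 /\ \det (jacobian F) = c%:MP.

Definition poly_automorphism (n : nat) (F : 'I_n -> {mpoly Cplx[n]}) : Prop :=
  exists G : 'I_n -> {mpoly Cplx[n]},
    (forall i : 'I_n, F i \mPo [tuple G j | j < n] = 'X_i) /\
    (forall i : 'I_n, G i \mPo [tuple F j | j < n] = 'X_i).

Definition jacobian_conjecture : Prop :=
  forall n : nat, (1 <= n)%N ->
    forall F : 'I_n -> {mpoly Cplx[n]}, keller_map F -> poly_automorphism F.

(* Main.v *)
(* After composing with automorphisms and adding variables, a Keller map takes the form [X - H]
   with [H] homogeneous of degree [d] and [JH ^ p = 0] for some [p].  The inverse power series of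
   [X - H] is the sum of the vectors [E_T] over all d-Catalan trees [T], where [E_T] is obtained by
   putting [X] at the leaves and the symmetric multilinear form of [H] at the internal vertices.
   Polarizing [JH ^ p = 0] shows that the sum of [E_T] over any shuffle class is zero.  A p-shuffle
   chain which preserves the uniform law on C_k rewrites the sum over C_k as a combination of such
   class sums; hence the inverse series has no terms from C_k for large k and is a polynomial. *)
Require Import Defs.
From mathcomp Require Import all_boot all_order all_algebra.
From mathcomp Require Import mpoly complex Rstruct.
From mathcomp Require Import ring zify.
Import GRing.Theory.
Local Open Scope ring_scope.
Set Implicit Arguments. Unset Strict Implicit. Unset Printing Implicit Defensive.

(** Chains are assumed for a single arity, so the reduction must end in exactly that homogeneous
    degree. A new variable [T] pads the quadratic and cubic terms; the cubic terms occur with [T] to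
    the power arity minus 3, whence the bound 3. The Keller condition is carried as [jinv], a
    polynomial inverse of the Jacobian matrix, which survives composition and added variables by the
    chain rule; for [X - H] it also yields nilpotency through a geometric series. The index [p]
    depends on [H], so chains are needed for every [p]. Along the path to a vertex, [E_T] is a
    product of matrices, one per level, each filled by the siblings of that level. Filling all slots
    of [p] levels with [X] gives [JH ^ p] up to a scalar, and polarization passes from this diagonal
    value to the sum over all arrangements. No power series are formed: sums over trees of bounded
    depth approximate the solution of G = X + H(G), and polynomials are compared by the lowest
    degree occurring in them. In the sections on forms and tree polynomials [d] is the arity minus
    one, the number of siblings. *)

Local Notation "p \mS F" := (mmap (@mpolyC _ _) F p) (at level 40, left associativity).

(** * Substitution, Jacobian matrices and polynomial automorphisms *)

Section PolynomialMaps.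
Variable K : fieldType.
Implicit Types n m k : nat.

(** Constants and variables generate the ring; identities between substitutions, and the chain rule,
    are thereby checked on these generators alone. *)
Lemma mpoly_ring_ind n (P : {mpoly K[n]} -> Prop) :
  (forall c, P c%:MP) -> (forall i, P 'X_i) ->
  (forall p q, P p -> P q -> P (p + q)) -> (forall p q, P p -> P q -> P (p * q)) ->
  forall p, P p.
Proof.
move=> PC PX PD PM p; rewrite (mpolyE p); apply: (big_ind P); [by rewrite -mpolyC0 | exact: (PD)|].
move=> m _; rewrite -mul_mpolyC; apply: (PM) => //.
rewrite mpolyXE_id; apply: (big_ind P); [by rewrite -mpolyC1 | exact: (PM)|].
move=> i _; elim: (m i) => [|e IHe]; first by rewrite expr0 -mpolyC1.
by rewrite exprS; apply: (PM).
Qed.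

Lemma msubstX n k (F : 'I_n -> {mpoly K[k]}) i : 'X_i \mS F = F i.
Proof. by rewrite mmapX mmap1U. Qed.

Lemma msubstC n k (F : 'I_n -> {mpoly K[k]}) c : c%:MP \mS F = c%:MP.
Proof. exact: mmapC. Qed.

Lemma eq_msubst n k (F G : 'I_n -> {mpoly K[k]}) : F =1 G -> forall p, p \mS F = p \mS G.
Proof.
move=> eqFG; elim/mpoly_ring_ind => [c|i|p q Ep Eq|p q Ep Eq].
- by rewrite !msubstC.
- by rewrite !msubstX.
- by rewrite !rmorphD /= Ep Eq.
- by rewrite !rmorphM /= Ep Eq.
Qed.

Lemma msubst_id n (F : 'I_n -> {mpoly K[n]}) p : (forall i, F i = 'X_i) -> p \mS F = p.
Proof.
move=> FE; elim/mpoly_ring_ind: p => [c|i|p q Ep Eq|p q Ep Eq].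
- by rewrite msubstC.
- by rewrite msubstX.
- by rewrite rmorphD /= Ep Eq.
- by rewrite rmorphM /= Ep Eq.
Qed.

Lemma msubstA n k l (F : 'I_n -> {mpoly K[k]}) (G : 'I_k -> {mpoly K[l]}) p :
  p \mS F \mS G = p \mS (fun i => F i \mS G).
Proof.
elim/mpoly_ring_ind: p => [c|i|p q Ep Eq|p q Ep Eq].
- by rewrite !msubstC.
- by rewrite !msubstX.
- by rewrite !rmorphD /= Ep Eq.
- by rewrite !rmorphM /= Ep Eq.
Qed.

Lemma comp_msubst n k (F : 'I_n -> {mpoly K[k]}) p : p \mPo [tuple F j | j < n] = p \mS F.
Proof. by apply: eq_msubst => i; rewrite tnth_mktuple. Qed.

Lemma mderivXU n (i j : 'I_n) : ('X_j)^`M(i) = (j == i)%:R :> {mpoly K[n]}.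
Proof.
rewrite mderivX mnm1E; case: eqP => [->|_]; last by rewrite scale0r.
by rewrite scale1r; have -> : (U_(i) - U_(i) = 0 :> 'X_{1..n})%MM
  by [apply/mnmP=> k; rewrite mnmBE mnm0E subnn]; rewrite mpolyX0.
Qed.

Lemma mderiv_msubst n k (F : 'I_n -> {mpoly K[k]}) p i :
  (p \mS F)^`M(i) = \sum_j (p^`M(j) \mS F) * (F j)^`M(i).
Proof.
elim/mpoly_ring_ind: p => [c|l|p q Ep Eq|p q Ep Eq].
- by rewrite msubstC mderivC big1 // => j _; rewrite mderivC rmorph0 mul0r.
- rewrite msubstX (bigD1 l) //= mderivXU eqxx rmorph1 mul1r big1 ?addr0 // => j.
  by rewrite mderivXU eq_sym => /negPf ->; rewrite rmorph0 mul0r.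
- rewrite rmorphD mderivD Ep Eq -big_split /=; apply: eq_bigr => j _.
  by rewrite mderivD rmorphD mulrDl.
- rewrite rmorphM mderivM Ep Eq /= mulr_suml mulr_sumr -big_split /=.
  by apply: eq_bigr => j _; rewrite mderivM rmorphD !rmorphM /= mulrDl mulrAC mulrA.
Qed.

Definition Jac n k (F : 'I_n -> {mpoly K[k]}) : 'M[{mpoly K[k]}]_(n, k) :=
  \matrix_(i, j) (F i)^`M(j).

Lemma Jac_comp n k l (F : 'I_n -> {mpoly K[k]}) (G : 'I_k -> {mpoly K[l]}) :
  Jac (fun i => F i \mS G) = map_mx (fun p => p \mS G) (Jac F) *m Jac G.
Proof.
by apply/matrixP=> i j; rewrite !mxE mderiv_msubst; apply: eq_bigr => s _; rewrite !mxE.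
Qed.

Lemma Jac_id n : Jac (fun i : 'I_n => 'X_i) = 1%:M.
Proof. by apply/matrixP=> i j; rewrite !mxE mderivXU. Qed.

Lemma eq_Jac n k (F G : 'I_n -> {mpoly K[k]}) : F =1 G -> Jac F = Jac G.
Proof. by move=> eqFG; apply/matrixP=> i j; rewrite !mxE eqFG. Qed.

(** Over a field this is the Keller condition: a right inverse makes the determinant a unit, and the
    units of a polynomial ring over a field are the nonzero constants. *)
Definition jinv n (F : 'I_n -> {mpoly K[n]}) : Prop := exists A, Jac F *m A = 1%:M.

Definition aut n (F : 'I_n -> {mpoly K[n]}) : Prop :=
  exists G : 'I_n -> {mpoly K[n]},
    (forall i, F i \mS G = 'X_i) /\ (forall i, G i \mS F = 'X_i).

Lemma eq_aut n (F G : 'I_n -> {mpoly K[n]}) : F =1 G -> aut F -> aut G.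
Proof.
move=> eqFG [F' [FF' F'F]]; exists F'; split=> i; first by rewrite -eqFG.
by rewrite -(eq_msubst eqFG).
Qed.

Lemma eq_jinv n (F G : 'I_n -> {mpoly K[n]}) : F =1 G -> jinv F -> jinv G.
Proof. by move=> /eq_Jac eqFG [A AE]; exists A; rewrite -eqFG. Qed.

Lemma aut_comp n (F G : 'I_n -> {mpoly K[n]}) :
  aut F -> aut G -> aut (fun i => F i \mS G).
Proof.
move=> [F' [FF' F'F]] [G' [GG' G'G]]; exists (fun i => G' i \mS F'); split=> i.
  rewrite msubstA (eq_msubst (G := F')) // => j.
  by rewrite -msubstA GG' msubstX.
rewrite msubstA (eq_msubst (G := G)) // => j.
by rewrite -msubstA F'F msubstX.
Qed.

Lemma jinv_comp n (F G : 'I_n -> {mpoly K[n]}) :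
  jinv F -> jinv G -> jinv (fun i => F i \mS G).
Proof.
move=> [A AE] [B BE]; exists (B *m map_mx (fun p => p \mS G) A).
rewrite Jac_comp mulmxA -(mulmxA _ (Jac G)) BE mulmx1 -map_mxM /= AE.
by rewrite map_scalar_mx /= rmorph1.
Qed.

(** Differentiating G(F) = X gives a left inverse of [Jac F]; for square matrices [mulmx1C] makes it
    a right inverse. *)
Lemma aut_jinv n (F : 'I_n -> {mpoly K[n]}) : aut F -> jinv F.
Proof.
move=> [G [FG GF]]; exists (map_mx (fun p => p \mS F) (Jac G)).
by apply: mulmx1C; rewrite -Jac_comp (eq_Jac GF) Jac_id.
Qed.

Lemma aut_sandwich n (E F G : 'I_n -> {mpoly K[n]}) :
  aut E -> aut G -> aut (fun i => E i \mS F \mS G) -> aut F.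
Proof.
move=> [E' [EE' E'E]] [G' [GG' G'G]] autEFG.
have autE' : aut E' by exists E.
have autG' : aut G' by exists G.
apply: eq_aut (aut_comp (aut_comp autE' autEFG) autG') => i.
rewrite msubstA (eq_msubst (G := fun j => E j \mS F)) => [|j].
  by rewrite -msubstA E'E msubstX.
rewrite msubstA msubst_id // => l.
Qed.

Lemma jinv_sandwich n (E F G : 'I_n -> {mpoly K[n]}) :
  aut E -> aut G -> jinv F -> jinv (fun i => E i \mS F \mS G).
Proof. by move=> /aut_jinv jE /aut_jinv jG jF; apply/jinv_comp/jG/jinv_comp. Qed.

Lemma aut_shear n (u : 'I_n -> {mpoly K[n]}) :
  (forall i, u i \mS (fun j => 'X_j + u j) = u i) ->
  (forall i, u i \mS (fun j => 'X_j - u j) = u i) ->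
  aut (fun i => 'X_i + u i).
Proof.
move=> uD uB; exists (fun i => 'X_i - u i); split=> i.
  by rewrite rmorphD /= msubstX uB subrK.
by rewrite rmorphB /= msubstX uD addrK.
Qed.

Definition vjoin T n m (f : 'I_n -> T) (g : 'I_m -> T) (i : 'I_(n + m)) : T :=
  match split i with inl j => f j | inr j => g j end.

Lemma vjoinl T n m (f : 'I_n -> T) (g : 'I_m -> T) i : vjoin f g (lshift m i) = f i.
Proof. by rewrite /vjoin (unsplitK (inl i)). Qed.

Lemma vjoinr T n m (f : 'I_n -> T) (g : 'I_m -> T) i : vjoin f g (rshift n i) = g i.
Proof. by rewrite /vjoin (unsplitK (inr i)). Qed.

Lemma forall_ord_add n m (P : 'I_(n + m) -> Prop) :
  (forall i, P (lshift m i)) -> (forall j, P (rshift n j)) -> forall i, P i.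
Proof. by move=> Pl Pr i; case: (split_ordP i) => j ->. Qed.

(** [Psi] is a family of maps parametrized by the last [m] coordinates, with [F] as its fiber over
    [y]. The inverse of [Psi] fixes these coordinates too, so its restriction to the fiber inverts
    [F]. *)
Lemma aut_fiber n m (F : 'I_n -> {mpoly K[n]}) (Psi : 'I_(n + m) -> {mpoly K[n + m]})
    (y : 'I_m -> K) :
  (forall j, Psi (rshift n j) = 'X_(rshift n j)) ->
  (forall i, Psi (lshift m i) \mS vjoin (fun i => 'X_i) (fun j => (y j)%:MP) = F i) ->
  aut Psi -> aut F.
Proof.
set iota := vjoin _ _ => Psir Psil [G [PG GP]].
have Gr j : G (rshift n j) = 'X_(rshift n j) by rewrite -(PG (rshift n j)) Psir msubstX.
pose G' i := G (lshift m i) \mS iota.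
have iG' i : iota i \mS G' = G i \mS iota.
  elim/forall_ord_add: i => i; first by rewrite /iota vjoinl msubstX.
  by rewrite Gr msubstX /iota vjoinr msubstC.
have iF i : iota i \mS F = Psi i \mS iota.
  elim/forall_ord_add: i => i; first by rewrite Psil /iota vjoinl msubstX.
  by rewrite Psir msubstX /iota vjoinr msubstC.
exists G'; split=> i.
  by rewrite -Psil msubstA (eq_msubst iG') -msubstA PG msubstX /iota vjoinl.
by rewrite msubstA (eq_msubst iF) -msubstA GP msubstX /iota vjoinl.
Qed.

(** The Jacobian matrix is block upper triangular with an identity block for the parameters, so
    inverting the fiberwise block is enough. *)
Lemma jinv_fiber n m (Psi : 'I_(n + m) -> {mpoly K[n + m]}) A :
  (forall j, Psi (rshift n j) = 'X_(rshift n j)) ->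
  (\matrix_(i, j) (Psi (lshift m i))^`M(lshift m j)) *m A = 1%:M -> jinv Psi.
Proof.
move=> Psir DA; set D := (\matrix_(i, j) _ : 'M_n) in DA.
pose B : 'M_(n, m) := \matrix_(i, j) (Psi (lshift m i))^`M(rshift n j).
rewrite /jinv; have -> : Jac Psi = block_mx D B 0 1%:M.
  apply/matrixP; elim/forall_ord_add => i; elim/forall_ord_add => j.
  - by rewrite block_mxEul !mxE.
  - by rewrite block_mxEur !mxE.
  - by rewrite block_mxEdl !mxE Psir mderivXU eq_rlshift.
  - by rewrite block_mxEdr !mxE Psir mderivXU eq_rshift.
exists (block_mx A (- (A *m B)) 0 1%:M).
rewrite mulmx_block !mulmx0 !mul0mx !mulmx1 !addr0 add0r mulmxN mulmxA DA mul1mx addNr.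
by rewrite -scalar_mx_block.
Qed.

Definition stabilize m n (F : 'I_n -> {mpoly K[n]}) : 'I_(n + m) -> {mpoly K[n + m]} :=
  vjoin (fun i => F i \mS (fun j => 'X_(lshift m j))) (fun j => 'X_(rshift n j)).

Arguments stabilize m [n] F _.

Lemma jinv_stabilize m n (F : 'I_n -> {mpoly K[n]}) : jinv F -> jinv (stabilize m F).
Proof.
move=> [A AE]; pose lX (j : 'I_n) : {mpoly K[n + m]} := 'X_(lshift m j).
apply: (@jinv_fiber _ _ _ (map_mx (fun p => p \mS lX) A)) => [j|].
  by rewrite /stabilize vjoinr.
rewrite [X in X *m _](_ : _ = map_mx (fun p => p \mS lX) (Jac F)).
  by rewrite -map_mxM /= AE map_scalar_mx /= rmorph1.
apply/matrixP=> i j; rewrite !mxE /stabilize vjoinl mderiv_msubst (bigD1 j) //=.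
rewrite mderivXU eqxx mulr1 big1 ?addr0 // => l nlj.
by rewrite mderivXU eq_lshift (negPf nlj) mulr0.
Qed.

Lemma aut_stabilize m n (F : 'I_n -> {mpoly K[n]}) : aut (stabilize m F) -> aut F.
Proof.
apply: (@aut_fiber _ m _ _ (fun=> 0)) => [j|i]; first by rewrite /stabilize vjoinr.
rewrite /stabilize vjoinl msubstA msubst_id // => j.
by rewrite msubstX vjoinl.
Qed.

End PolynomialMaps.

(** * Reduction to degree at most three *)

Section DegreeReduction.
Variable K : fieldType.
Implicit Types n m k : nat.

(** The hypothesis expresses that [u] involves only variables that it does not move; it covers the
    shifts by [u] and by [- u] at once. *)
Lemma aut_shear_zero n (u : 'I_n -> {mpoly K[n]}) :
  (forall S : 'I_n -> {mpoly K[n]}, (forall i, u i = 0 -> S i = 'X_i) ->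
    forall i, u i \mS S = u i) ->
  aut (fun i => 'X_i + u i).
Proof.
by move=> uS; apply: aut_shear; apply: uS => i ->; rewrite ?addr0 ?subr0.
Qed.

Lemma msubst_sum n k (F : 'I_n -> {mpoly K[k]}) (I : finType) (f : I -> {mpoly K[n]}) :
  (\sum_i f i) \mS F = \sum_i f i \mS F.
Proof. exact: rmorph_sum. Qed.

Lemma msizeM_leq n (p q : {mpoly K[n]}) a b :
  (msize p <= a.+1)%N -> (msize q <= b.+1)%N -> (msize (p * q) <= (a + b).+1)%N.
Proof.
have [->|p0] := eqVneq p 0; first by rewrite mul0r mmeasure0.
have [->|q0] := eqVneq q 0; first by rewrite mulr0 mmeasure0.
rewrite msizeM //; move: (mmeasure _ p) (mmeasure _ q) => x y; lia.
Qed.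

Lemma msizeD_leq n (p q : {mpoly K[n]}) a :
  (msize p <= a)%N -> (msize q <= a)%N -> (msize (p + q) <= a)%N.
Proof. by move=> pa qa; apply: leq_trans (mmeasureD_le _ _ _) _; rewrite geq_max pa. Qed.

Lemma msize_sum_leq n (I : finType) (p : I -> {mpoly K[n]}) a :
  (forall i, msize (p i) <= a)%N -> (msize (\sum_i p i) <= a)%N.
Proof.
move=> pa; apply: (big_ind (fun p => msize p <= a)%N) => //; first by rewrite mmeasure0.
by move=> q r; apply: msizeD_leq.
Qed.

Lemma mnm_split n (mu : 'X_{1..n}) k : (k <= mdeg mu)%N ->
  exists al be, mu = (al + be)%MM /\ mdeg al = k.
Proof.
elim: k => [|k IHk] kmu.
  by exists 0%MM, mu; rewrite add0m mdeg0.
have [al [be [muE alk]]] := IHk (ltnW kmu).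
have /negP nz : mdeg be != 0%N by move: kmu; rewrite muE mdegD alk; lia.
have [i bei] : exists i, be i != 0%N.
  apply/existsP; apply: contra_notT nz; rewrite negb_exists mdegE => /forallP be0.
  by rewrite big1 // => i _; apply/eqP; rewrite -[_ == _]negbK be0.
exists (al + U_(i))%MM, (be - U_(i))%MM; split; last by rewrite mdegD alk mdeg1 addn1.
by rewrite muE -addmA [(U_(i) + _)%MM]addmC submK // lep1mP.
Qed.

Lemma msize_monomial_rename n k (g : 'I_n -> 'I_k) (m : 'X_{1..n}) :
  msize ('X_[K, m] \mS (fun i => 'X_(g i))) = (mdeg m).+1.
Proof.
rewrite mmapX /mmap1 (mprodXnE _ _ _ (fun i => m i)) msizeX mdeg_sum; congr _.+1.
by rewrite mdegE; apply: eq_bigr => i _; rewrite mdegMn mdeg1 mul1n.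
Qed.

(* Writing each monomial as a product [P_j * Q_j] and shifting two new variables
   [U_j], [V_j] by [P_j], [Q_j], the difference
   [P_j * Q_j - (U_j + P_j) * (V_j + Q_j)] no longer contains that monomial. *)
Lemma reduce_degree D : (4 <= D)%N ->
  (forall n (F : 'I_n -> {mpoly K[n]}), (forall i, msize (F i) <= D)%N -> jinv F -> aut F) ->
  (forall n (F : 'I_n -> {mpoly K[n]}), (forall i, msize (F i) <= D.+1)%N -> jinv F -> aut F).
Proof.
move=> D4 IHD n F FD jF.
pose M := #|{: 'X_{1..n < D.+1}}|.
pose ev : 'I_M -> 'X_{1..n < D.+1} := @enum_val _ _.
(* Splitting off degree 2 leaves the products [U V], [U Q] and [P V], of degrees at most 2, [D - 1]
   and 3; all are at most [D - 1] since [4 <= D]. Monomials of degree below 2 go entirely into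
   [al]. *)
have /fin_all_exists [al /fin_all_exists [be albe]] (j : 'I_M) : exists al be : 'X_{1..n},
    [/\ (ev j : 'X_{1..n}) = (al + be)%MM, (mdeg al <= 2)%N & (mdeg be <= D - 2)%N].
  have jD := bmdeg (ev j); move: (bmnm _) jD => mu muD.
  have [|a [b [muE aE]]] := @mnm_split _ mu (minn 2 (mdeg mu)); first by lia.
  by exists a, b; split=> //; move: muD aE; rewrite muE mdegD; lia.
pose c i j := (F i)@_(ev j).
have FE i : F i = \sum_j c i j *: ('X_[al j] * 'X_[be j]).
  rewrite {1}(mpolywE (FD i)) (reindex ev) /=; last first.
    exact/onW_bij/enum_val_bij.
  by apply: eq_bigr => j _; rewrite /c; have [-> _ _] := albe j; rewrite mpolyXD.
pose lX (i : 'I_n) : {mpoly K[n + (M + M)]} := 'X_(lshift (M + M) i).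
pose U j : {mpoly K[n + (M + M)]} := 'X_(rshift n (lshift M j)).
pose V j : {mpoly K[n + (M + M)]} := 'X_(rshift n (rshift M j)).
pose R := {mpoly K[n + (M + M)]}.
pose P (j : 'I_M) : R := 'X_[al j] \mS lX; pose Q (j : 'I_M) : R := 'X_[be j] \mS lX.
pose u1 : 'I_(n + (M + M)) -> R := vjoin (fun i => - \sum_j c i j *: (U j * V j)) (fun=> 0).
pose u2 : 'I_(n + (M + M)) -> R := vjoin (fun=> 0) (vjoin P Q).
apply: (@aut_stabilize _ (M + M)).
have aut1 : aut (fun i => 'X_i + u1 i).
  apply: aut_shear_zero => S SE i; elim/forall_ord_add: i => i; rewrite /u1 ?vjoinl ?vjoinr ?rmorph0 //.
  rewrite rmorphN /= msubst_sum; congr (- _); apply: eq_bigr => j _ /=.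
  by rewrite -mul_mpolyC !rmorphM /= msubstC !msubstX !SE // /u1 vjoinr.
have aut2 : aut (fun i => 'X_i + u2 i).
  apply: aut_shear_zero => S SE i.
  have SlX p : p \mS lX \mS S = p \mS lX.
    by rewrite msubstA; apply: eq_msubst => j; rewrite msubstX SE // /u2 vjoinl.
  elim/forall_ord_add: i => i; rewrite /u2 ?vjoinl ?vjoinr ?rmorph0 //.
  by elim/forall_ord_add: i => i; rewrite ?vjoinl ?vjoinr SlX.
apply: (aut_sandwich aut1 aut2); apply: IHD; last first.
  exact/jinv_sandwich/jinv_stabilize.
have lXS p : p \mS lX \mS (fun i => 'X_i + u2 i) = p \mS lX.
  by rewrite msubstA; apply: eq_msubst => j; rewrite msubstX /u2 vjoinl addr0.
have PD j : (msize (P j) <= 3)%N by rewrite msize_monomial_rename; have [] := albe j.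
have QD j : (msize (Q j) <= (D - 2).+1)%N by rewrite msize_monomial_rename; have [] := albe j.
have UD j : (msize (U j) <= 2)%N by rewrite msizeX mdeg1.
have VD j : (msize (V j) <= 2)%N by rewrite msizeX mdeg1.
move=> i; elim/forall_ord_add: i => i.
  rewrite /u1 vjoinl rmorphD /= msubstX /stabilize vjoinl.
  rewrite [X in (_ + X) \mS _](_ : _ = - \sum_j c i j *: (U j * V j)); last first.
    rewrite rmorphN /= msubst_sum; congr (- _); apply: eq_bigr => j _ /=.
    by rewrite -mul_mpolyC !rmorphM /= msubstC !msubstX !vjoinr.
  rewrite rmorphB /= FE !msubst_sum -sumrB.
  apply: msize_sum_leq => j /=.
  rewrite -!mul_mpolyC !rmorphM /= !msubstC !msubstX.
  rewrite [X in _ - _ * X](_ : _ = (U j + P j) * (V j + Q j)); last first.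
    by rewrite /u2 !vjoinr vjoinl.
  rewrite ![_ \mS lX \mS _]lXS -/(P j) -/(Q j).
  rewrite (_ : _ - _ = - (c i j)%:MP * (U j * V j + (U j * Q j + P j * V j))); last by ring.
  rewrite mulNr mmeasureN (_ : D = (0 + D.-1).+1); last by lia.
  apply: (@msizeM_leq _ _ _ 0); first by rewrite mmeasureC; case: eqP.
  apply: msizeD_leq; last apply: msizeD_leq.
  - by apply: leq_trans (msizeM_leq (UD j) (VD j)) _; lia.
  - by apply: leq_trans (msizeM_leq (UD j) (QD j)) _; lia.
  - by apply: leq_trans (msizeM_leq (PD j) (VD j)) _; lia.
rewrite /u1 vjoinr addr0 msubstX /stabilize vjoinr msubstX.
apply: msizeD_leq; first by rewrite msizeX mdeg1; lia.
rewrite /u2 vjoinr; elim/forall_ord_add: i => i; rewrite ?vjoinl ?vjoinr.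
  by apply: leq_trans (PD i) _; lia.
by apply: leq_trans (QD i) _; lia.
Qed.

Lemma jacobian_of_cubic :
  (forall n (F : 'I_n -> {mpoly K[n]}), (forall i, msize (F i) <= 4)%N -> jinv F -> aut F) ->
  forall n (F : 'I_n -> {mpoly K[n]}), jinv F -> aut F.
Proof.
(* [msize] is the degree plus one, so 4 is the cubic bound; adding 4 starts the induction there and
   provides [4 <= D] at each step. *)
move=> IH3 n F; pose D := (\max_i msize (F i) + 4)%N.
have : forall i, (msize (F i) <= D)%N.
  by move=> i; apply: leq_trans (leq_addr _ _); apply: (@leq_bigmax _ (fun i => msize (F i))).
rewrite {}/D; move: (\max_i _)%N => D.
elim: D => [|D IHD] in n F *; first exact: IH3.
by apply: reduce_degree; rewrite ?leq_addl // => k G GD; apply: IHD.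
Qed.

End DegreeReduction.

(** * Homogeneous parts and normalization of the constant and linear terms *)

Section Homogenization.
Variable K : fieldType.
Implicit Types n m k : nat.

Lemma mcoeff_pihomog n k (p : {mpoly K[n]}) (m : 'X_{1..n}) :
  (pihomog mdeg k p)@_m = if mdeg m == k then p@_m else 0.
Proof.
case: eqP => [<-|/eqP mk]; last exact: (dhomog_nemf_coeff (pihomogP _ _ _)).
have mlt : (mdeg m < maxn (msize p) (mdeg m).+1)%N by rewrite leq_max leqnn orbT.
rewrite [in RHS](pihomog_partitionE (leq_maxl (msize p) (mdeg m).+1)) [RHS](raddf_sum (mcoeff m)) /=.
rewrite [RHS](bigD1 (Ordinal mlt)) //= [X in _ + X]big1 ?addr0 // => j njm.
apply: (dhomog_nemf_coeff (pihomogP _ _ _)).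
by apply: contraNneq njm => jE; apply/eqP/val_inj; rewrite /= -jE.
Qed.

Lemma msubst_scale n k l (p : {mpoly K[n]}) (s : {mpoly K[k]}) (G : 'I_n -> {mpoly K[k]}) :
  p \is l.-homog -> p \mS (fun i => s * G i) = s ^+ l * (p \mS G).
Proof.
move=> /dhomogP pl; rewrite (mpolyE p) !big_seq.
rewrite !rmorph_sum /= mulr_sumr; apply: eq_bigr => m /pl /= mE.
rewrite -mul_mpolyC !rmorphM /= !msubstC !mmapX /mmap1 mulrCA; congr (_ * _).
rewrite -mE mdegE -prodrXr -big_split /=; apply: eq_bigr => i _.
by rewrite exprMn.
Qed.

Lemma dhomog_rename n k l (g : 'I_n -> 'I_k) (p : {mpoly K[n]}) :
  p \is l.-homog -> p \mS (fun i => 'X_(g i)) \is l.-homog.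
Proof.
move=> /dhomogP pl; rewrite (mpolyE p) big_seq rmorph_sum /=.
apply: rpred_sum => m /pl /= mE.
rewrite -mul_mpolyC rmorphM /= msubstC mul_mpolyC; apply: rpredZ.
rewrite mmapX /mmap1 (mprodXnE _ _ _ (fun i => m i)) dhomogX /= mdeg_sum -mE mdegE.
by apply/eqP/eq_bigr => i _; rewrite mdegMn mdeg1 mul1n.
Qed.

Lemma dhomogXU n (i : 'I_n) : ('X_i : {mpoly K[n]}) \is 1.-homog.
Proof. by rewrite dhomogX /= mdeg1. Qed.

Definition normalized n (F N2 N3 : 'I_n -> {mpoly K[n]}) : Prop :=
  [/\ forall i, N2 i \is 2.-homog, forall i, N3 i \is 3.-homog &
      forall i, F i = 'X_i - N2 i - N3 i].

Lemma jacobian_of_normalized :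
  (forall n (F N2 N3 : 'I_n -> {mpoly K[n]}), normalized F N2 N3 -> jinv F -> aut F) ->
  forall n (F : 'I_n -> {mpoly K[n]}), jinv F -> aut F.
Proof.
move=> autN; apply: jacobian_of_cubic => n F F4 jF.
have [A FA] := jF.
(* Taking constant terms is a ring morphism, evaluation at the origin, so [Jac F *m A = 1] makes the
   linear part [L] invertible with inverse [B]. The affine map [E] undoes [L] and the constant term
   [a]. *)
pose L : 'M[K]_n := \matrix_(i, j) (F i)@_U_(j).
pose B : 'M[K]_n := map_mx (mcoeff 0%MM) A.
have LB : L *m B = 1%:M.
  have <- : map_mx (mcoeff 0%MM) (Jac F) = L.
    by apply/matrixP=> i j; rewrite !mxE mcoeff_deriv add0m mnm0E mulr1n.
  by rewrite -map_mxM /= FA map_scalar_mx /= mcoeff1 eqxx.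
have BL := mulmx1C LB.
pose a i := (F i)@_0%MM.
pose E i : {mpoly K[n]} := \sum_j (B i j)%:MP * ('X_j - (a j)%:MP).
have autE : aut E.
  exists (fun i => \sum_j (L i j)%:MP * 'X_j + (a i)%:MP); split=> i.
    rewrite /E msubst_sum.
    under eq_bigr => j _ do rewrite rmorphM rmorphB /= !msubstC msubstX addrK mulr_sumr.
    rewrite exchange_big /= (bigD1 i) //= [X in _ + X]big1 => [|k /negPf nki].
      rewrite addr0; under eq_bigr => j _ do rewrite mulrA -mpolyCM.
      rewrite -mulr_suml -rmorph_sum /=.
      by have /matrixP/(_ i i) := BL; rewrite !mxE eqxx => ->; rewrite mul1r.
    under eq_bigr => j _ do rewrite mulrA -mpolyCM.
    rewrite -mulr_suml -rmorph_sum /=.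
    by have /matrixP/(_ i k) := BL; rewrite !mxE eq_sym nki => ->; rewrite mul0r.
  rewrite rmorphD /= msubstC msubst_sum.
  under eq_bigr => j _ do rewrite rmorphM /= msubstC msubstX mulr_sumr.
  rewrite exchange_big /= (bigD1 i) //= [X in _ + X + _]big1 => [|k /negPf nki].
    rewrite addr0; under eq_bigr => j _ do rewrite mulrA -mpolyCM.
    rewrite -mulr_suml -rmorph_sum /=.
    have /matrixP/(_ i i) := LB; rewrite !mxE eqxx => ->.
    by rewrite mul1r subrK.
  under eq_bigr => j _ do rewrite mulrA -mpolyCM.
  rewrite -mulr_suml -rmorph_sum /=.
  by have /matrixP/(_ i k) := LB; rewrite !mxE eq_sym nki => ->; rewrite mul0r.
have autX : aut (fun i : 'I_n => 'X_i : {mpoly K[n]}).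
  by exists (fun i => 'X_i); split=> i; rewrite msubstX.
apply: (aut_sandwich autE autX).
pose F' i := E i \mS F.
have F'E i : F' i = \sum_j B i j *: (F j - (a j)%:MP).
  rewrite /F' /E msubst_sum; apply: eq_bigr => j _.
  by rewrite rmorphM rmorphB /= !msubstC msubstX mul_mpolyC.
have F'4 i : (msize (F' i) <= 4)%N.
  rewrite F'E; apply: msize_sum_leq => j; apply: leq_trans (msizeZ_le _ _) _.
  by apply: msizeD_leq => //; rewrite mmeasureN mmeasureC; case: eqP.
have jF' : jinv F' by have := jinv_sandwich autE autX jF; apply: eq_jinv => i; rewrite msubst_id.
have autF' : aut F'; last by apply: eq_aut autF' => i; rewrite [RHS]msubst_id.
apply: (@autN _ _ (fun i => - pihomog mdeg 2 (F' i)) (fun i => - pihomog mdeg 3 (F' i)) _ jF').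
split=> i; rewrite ?rpredN ?pihomogP // !opprK.
rewrite {1}(pihomog_partitionE (F'4 i)) !big_ord_recr big_ord0 /= add0r.
congr (_ + _ + _).
(* Degrees 0 and 1 remain: [F'] vanishes at the origin, and its linear part is [B *m L], the
   identity. *)
apply/mpolyP => m; rewrite mcoeffD !mcoeff_pihomog mcoeffX.
have [m0|nm0] := eqVneq (mdeg m) 0%N.
  move/eqP: m0; rewrite mdeg_eq0 => /eqP ->; rewrite mdeg0 addr0.
  rewrite -[_ == _]/(U_(i)%MM == 0%MM) mnm1_eq0 F'E raddf_sum big1 //= => j _.
  by rewrite mcoeffZ mcoeffB mcoeffC eqxx mulr1 subrr mulr0.
rewrite add0r; case: eqP => [/eqP/mdeg1P[k /eqP ->]|/eqP nm1]; last first.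
  rewrite (_ : _ == m = false) //.
  by apply: contraNF nm1 => /eqP <-; rewrite mdeg1.
rewrite eq_mnm1 F'E raddf_sum /=.
have /matrixP/(_ i k) := BL; rewrite !mxE => <-.
by apply: eq_bigr => j _; rewrite mcoeffZ mcoeffB mcoeffC mnm1_eq0 mulr0 subr0 [L j k]mxE.
Qed.

End Homogenization.

(** * Reduction to a single homogeneous degree *)

Section HomogeneousReduction.
Variable K : fieldType.
Implicit Types n m k : nat.

(* With [S = T^(e+1)], shifting [Y] by [T^e N3(X)] and then [X] by [T^(e+2) Y] cancels the
   term [S^2 N3(X)] of [S^-1 F(S X) = X - S N2(X) - S^2 N3(X)]; what is left is homogeneous. *)
Lemma jacobian_of_homogeneous e :
  (forall n (H : 'I_n -> {mpoly K[n]}), (forall i, H i \is (e.+3).-homog) ->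
    jinv (fun i => 'X_i - H i) -> aut (fun i => 'X_i - H i)) ->
  forall n (F : 'I_n -> {mpoly K[n]}), jinv F -> aut F.
Proof.
move=> autH; apply: jacobian_of_normalized => n F N2 N3 [N2h N3h FE] [A FA].
pose R := {mpoly K[n + (n + 1)]}.
pose lX (i : 'I_n) : R := 'X_(lshift (n + 1) i).
pose Y (j : 'I_n) : R := 'X_(rshift n (lshift 1 j)).
pose T : R := 'X_(rshift n (rshift n ord0)).
pose S := T ^+ e.+1.
pose Psi : 'I_(n + (n + 1)) -> R :=
  vjoin (fun i => lX i - S * (N2 i \mS lX) - S * S * (N3 i \mS lX)) (fun j => 'X_(rshift n j)).
have PsiF : aut Psi -> aut F.
  (* On the fiber [Y = 0], [T = 1] the power [S] becomes 1 and [Psi] restricts to [F]. *)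
  apply: (@aut_fiber _ _ _ _ _ (vjoin (fun=> 0) (fun=> 1))) => [j|i].
    by rewrite /Psi vjoinr.
  rewrite /Psi vjoinl !rmorphB !rmorphM /= !rmorphXn /= !msubstX !vjoinr vjoinl.
  rewrite mpolyC1 !expr1n mulr1 !mul1r FE !msubstA.
  by rewrite !(msubst_id (F := fun i => lX i \mS _)) // => j; rewrite msubstX vjoinl.
have jPsi : jinv Psi.
  pose sX i := S * lX i.
  apply: (@jinv_fiber _ _ _ _ (map_mx (fun p => p \mS sX) A)) => [j|].
    by rewrite /Psi vjoinr.
  rewrite [X in X *m _](_ : _ = map_mx (fun p => p \mS sX) (Jac F)).
    by rewrite -map_mxM /= FA map_scalar_mx /= rmorph1.
  have dS j : S^`M(lshift (n + 1) j) = 0.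
    by rewrite /S /T mpolyXn mderivX mulmnE mnm1E eq_rlshift scale0r.
  have S0 : S != 0 by rewrite expf_neq0 // -msize_poly_eq0 msizeX.
  (* The derivative of [Psi] in [X] is [JF] taken at [S X]. Instead of dividing F(S X) by [S], both
     sides are multiplied by [S], which is nonzero and free of [X]. *)
  apply/matrixP=> i j; rewrite !mxE; apply: (mulfI S0).
  transitivity ((F i \mS sX)^`M(lshift (n + 1) j)).
    rewrite FE !rmorphB /= msubstX /sX !(msubst_scale _ _ (N2h i)) (msubst_scale _ _ (N3h i)).
    rewrite /Psi vjoinl (_ : S * lX i - _ - _ = S * (lX i - S * (N2 i \mS lX) - S * S * (N3 i \mS lX))).
      by rewrite [RHS]mderivM dS mul0r add0r.
    by ring.
  rewrite mderiv_msubst (bigD1 j) //= mderivM dS mul0r add0r mderivXU eqxx mulr1 mulrC.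
  rewrite big1 ?addr0 // => k nkj.
  by rewrite mderivM dS mul0r add0r mderivXU eq_lshift (negPf nkj) mulr0 mulr0.
apply: PsiF.
(* The exponents are forced: [T^(e+2) Y] and [T^e N3] must have degree [e + 3], and their powers of
   [T] multiply to [S^2]. *)
pose u1 : 'I_(n + (n + 1)) -> R := vjoin (fun i => T ^+ e.+2 * Y i) (fun=> 0).
pose u2 : 'I_(n + (n + 1)) -> R :=
  vjoin (fun=> 0) (vjoin (fun j => T ^+ e * (N3 j \mS lX)) (fun=> 0)).
have aut1 : aut (fun i => 'X_i + u1 i).
  apply: aut_shear_zero => U UE i; elim/forall_ord_add: i => i; rewrite /u1 ?vjoinl ?vjoinr ?rmorph0 //.
  by rewrite rmorphM rmorphXn /= !msubstX !UE // /u1 vjoinr.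
have aut2 : aut (fun i => 'X_i + u2 i).
  apply: aut_shear_zero => U UE i; elim/forall_ord_add: i => i; rewrite /u2 ?vjoinl ?vjoinr ?rmorph0 //.
  elim/forall_ord_add: i => i; rewrite ?vjoinl ?vjoinr ?rmorph0 //.
  rewrite rmorphM rmorphXn /= msubstX UE; last by rewrite /u2 !vjoinr.
  by congr (_ * _); rewrite msubstA; apply: eq_msubst => j; rewrite msubstX UE // /u2 vjoinl.
pose H : 'I_(n + (n + 1)) -> R :=
  vjoin (fun i => S * (N2 i \mS lX) - T ^+ e.+2 * Y i)
        (vjoin (fun j => - (T ^+ e * (N3 j \mS lX))) (fun=> 0)).
have PhiE i : ('X_i + u1 i) \mS Psi \mS (fun i => 'X_i + u2 i) = 'X_i - H i.
  have lXS p : p \mS lX \mS (fun i => 'X_i + u2 i) = p \mS lX.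
    by rewrite msubstA; apply: eq_msubst => j; rewrite msubstX /u2 vjoinl addr0.
  have TS k : (T ^+ k) \mS (fun i => 'X_i + u2 i) = T ^+ k.
    by rewrite rmorphXn /= msubstX /u2 !vjoinr addr0.
  elim/forall_ord_add: i => i.
    rewrite /u1 vjoinl rmorphD rmorphM rmorphXn /= !msubstX /Psi vjoinl !vjoinr -/T.
    rewrite rmorphD !rmorphB !rmorphM /= !lXS !TS !msubstX /u2 /H !vjoinl !vjoinr !vjoinl.
    rewrite !addr0 -/T -/(Y i) -/(lX i) /S.
    rewrite !exprS.
    by ring.
  rewrite /u1 vjoinr addr0 msubstX /Psi vjoinr msubstX /u2 /H !vjoinr.
  by elim/forall_ord_add: i => i; rewrite ?vjoinl ?vjoinr ?opprK ?addr0 ?subr0.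
apply: (aut_sandwich aut1 aut2).
apply: (@eq_aut _ _ (fun i => 'X_i - H i)) => [i|]; first by rewrite PhiE.
apply: autH => [i|]; last first.
  by apply: eq_jinv (jinv_sandwich aut1 aut2 jPsi) => i; rewrite PhiE.
have Th k : T ^+ k \is k.-homog.
  by rewrite -[X in X.-homog]mul1n; apply/dhomogMn/dhomogXU.
elim/forall_ord_add: i => i; rewrite /H ?vjoinl ?vjoinr.
  apply: rpredB.
    by rewrite (_ : e.+3 = (e.+1 + 2)%N); [|lia]; apply: dhomogM (Th _) (dhomog_rename _ (N2h i)).
  by rewrite -[e.+3]addn1; apply: dhomogM (Th _) (dhomogXU _ _).
elim/forall_ord_add: i => i; rewrite ?vjoinl ?vjoinr; last exact: rpred0.
by rewrite rpredN -addn3; apply: dhomogM (Th _) (dhomog_rename _ (N3h i)).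
Qed.

End HomogeneousReduction.

(** * Words, tensor coordinates and sums over arrangements *)

Section Words.
Variables (K : fieldType) (n : nat).
Local Notation R := {mpoly K[n]}.
Local Notation vec := ('I_n -> R).
Local Notation word := (seq 'I_n).
Implicit Types (w l : word) (ts us : seq vec) (i j : 'I_n).

Definition genvec : vec := fun i => 'X_i.

(** The coordinate at [w] of the tensor product of the vectors [ts]. *)
Definition wprod ts w : R := \prod_(q <- zip ts w) q.1 q.2.

Definition ins T q (x : T) s := take q s ++ x :: drop q s.

Lemma wprod_cat ts1 ts2 w1 w2 : size ts1 = size w1 ->
  wprod (ts1 ++ ts2) (w1 ++ w2) = wprod ts1 w1 * wprod ts2 w2.
Proof. by move=> eqsz; rewrite /wprod zip_cat // big_cat. Qed.

Lemma wprod_cons t ts i w : wprod (t :: ts) (i :: w) = t i * wprod ts w.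
Proof. by rewrite /wprod /= big_cons. Qed.

Lemma wprod_ins q y us j l : size us = size l ->
  wprod (ins q y us) (ins q j l) = y j * wprod us l.
Proof.
move=> eqsz; rewrite /ins wprod_cat ?size_take ?eqsz // wprod_cons mulrCA; congr (_ * _).
by rewrite -wprod_cat ?size_take ?eqsz // !cat_take_drop.
Qed.

Lemma wprod_nseqE N (u : vec) w : size w = N -> wprod (nseq N u) w = \prod_(i <- w) u i.
Proof.
move=> <-; elim: w => [|i w IHw] /=; first by rewrite /wprod !big_nil.
by rewrite wprod_cons IHw big_cons.
Qed.

Lemma wprod_nseq N w : size w = N -> wprod (nseq N genvec) w = \prod_(i <- w) 'X_i.
Proof. exact: wprod_nseqE. Qed.

Lemma big_tuple_ins q d (f : word -> R) : (q <= d)%N ->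
  \sum_(w : d.+1.-tuple 'I_n) f w = \sum_j \sum_(l : d.-tuple 'I_n) f (ins q j l).
Proof.
move=> qd; rewrite pair_big /=.
have sz (x : 'I_n * d.-tuple 'I_n) : size (ins q x.1 x.2) == d.+1.
  by rewrite size_cat /= addnS -size_cat cat_take_drop size_tuple.
pose g x := Tuple (sz x).
rewrite (reindex g) //; apply: onW_bij; apply: inj_card_bij; last first.
  by rewrite card_prod !card_tuple card_ord expnS.
move=> [j l] [j' l'] /(congr1 val) /eqP /=.
rewrite /ins eqseq_cat ?size_take ?size_tuple // eqseq_cons => /and3P[/eqP e1 /eqP -> /eqP e2].
by congr pair; apply/val_inj; rewrite /= -(cat_take_drop q l) e1 e2 cat_take_drop.
Qed.

Lemma big_tuple_cat a b (f : word -> R) :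
  \sum_(w : (a + b).-tuple 'I_n) f w =
  \sum_(u : a.-tuple 'I_n) \sum_(v : b.-tuple 'I_n) f (u ++ v).
Proof.
rewrite pair_big /= (reindex (fun x : a.-tuple 'I_n * b.-tuple 'I_n => cat_tuple x.1 x.2)) //.
apply: onW_bij; apply: inj_card_bij; last by rewrite card_prod !card_tuple expnD.
move=> [u v] [u' v'] /(congr1 val) /eqP /=.
rewrite eqseq_cat ?size_tuple // => /andP[/eqP e1 /eqP e2].
by congr pair; apply/val_inj.
Qed.

Definition mword w : 'X_{1..n} := (\sum_(i <- w) U_(i))%MM.

Lemma prodX_mword w : \prod_(i <- w) 'X_i = 'X_[mword w] :> R.
Proof. exact: mprodXE. Qed.

Lemma mword_count w i : mword w i = count_mem i w.
Proof.
rewrite /mword mnm_sumE -sum1_count [in RHS]big_mkcond; apply: eq_bigr => j _.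
by rewrite mnm1E /=; case: eqP.
Qed.

Lemma mdeg_mword w : mdeg (mword w) = size w.
Proof. by rewrite mdeg_sum (eq_bigr (fun=> 1%N)) ?sum1_size // => i _; rewrite mdeg1. Qed.

Lemma perm_mword w w' : (mword w == mword w') = perm_eq w w'.
Proof.
apply/eqP/idP => [e|/permP p].
  by apply/allP => i _ /=; rewrite -!mword_count e.
by apply/mnmP => i; rewrite !mword_count p.
Qed.

Section ShuffleSum.
Variables (T : eqType) (V : T -> vec) (s : seq T).

(** [permutations] lists each distinct arrangement once, which is how a shuffle class counts its
    trees when some subtrees coincide. *)
Let Q w : R := \sum_(ts <- permutations s) wprod (map V ts) w.

(** Exchanging two blocks of the word amounts to exchanging the matching blocks of factors, and
    [phi] does this bijectively on the arrangements of [s]. Such exchanges generate all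
    rearrangements of the word. *)
Let Q_catCA a b c : size (a ++ b ++ c) = size s -> Q (b ++ a ++ c) = Q (a ++ b ++ c).
Proof.
move=> szs; pose na := size a; pose nb := size b.
pose phi (ts : seq T) := rot na (take (na + nb) ts) ++ drop (na + nb) ts.
have phi_perm (ts : seq T) : perm_eq (phi ts) ts.
  by rewrite -[X in perm_eq _ X](cat_take_drop (na + nb)) perm_cat2r perm_rot.
have phi_inj : {in permutations s &, injective phi}.
  move=> t1 t2; rewrite !mem_permutations => /perm_size z1 /perm_size z2 /eqP.
  rewrite /phi eqseq_cat ?size_rot ?size_take ?z1 ?z2 //.
  move=> /andP[/eqP/rot_inj e1 /eqP e2].
  by rewrite -(cat_take_drop (na + nb) t1) e1 e2 cat_take_drop.
have perm_phi : perm_eq (map phi (permutations s)) (permutations s).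
  apply: uniq_perm => [||ts]; rewrite ?permutations_uniq ?map_inj_in_uniq ?permutations_uniq //.
  have sub : {subset map phi (permutations s) <= permutations s}.
    move=> _ /mapP[t tP ->]; move: tP; rewrite !mem_permutations.
    exact: perm_trans (phi_perm t).
  have u : uniq (map phi (permutations s)) by rewrite map_inj_in_uniq ?permutations_uniq.
  exact: (uniq_min_size u sub (eq_leq (esym (size_map _ _)))).2.
rewrite /Q -(perm_big _ perm_phi) big_map big_seq [RHS]big_seq.
apply: eq_bigr => ts; rewrite mem_permutations => /perm_size zts.
rewrite !size_cat -/na -/nb in szs.
have zu : size (take na ts) = na by rewrite size_takel // zts; lia.
have zv : size (take nb (drop na ts)) = nb by rewrite size_takel // size_drop zts; lia.
have tsE : ts = take na ts ++ take nb (drop na ts) ++ drop (na + nb) ts.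
  by rewrite catA -takeD cat_take_drop.
have -> : phi ts = take nb (drop na ts) ++ take na ts ++ drop (na + nb) ts.
  by rewrite /phi takeD -{1}zu rot_size_cat catA.
rewrite [in RHS]tsE !map_cat !wprod_cat ?size_map //.
exact: mulrCA.
Qed.

Let Q_perm w w' : size w = size s -> perm_eq w w' -> Q w = Q w'.
Proof.
move=> zw pw; have zw' : size w' = size s by rewrite -(perm_size pw).
apply: (@catCA_perm_ind _ (fun u => size u = size s -> Q w = Q u) _ _ _ pw _ zw') => //.
move=> a b c IH zabc.
  have zabc' : size (a ++ b ++ c) = size s by rewrite -zabc !size_cat addnCA.
  by rewrite Q_catCA // IH.
Qed.

(* Summing over all arrangements of the factors makes the coefficient of [c w] depend on the
   content of [w] only, so that the sum is a combination of the coefficients of the commutative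
   polynomial obtained by substituting the generic vector for every factor. *)
Lemma shuffle_sum_eq0 N (c : word -> K) : size s = N ->
  \sum_(w : N.-tuple 'I_n) c w *: wprod (nseq N genvec) w = 0 ->
  \sum_(ts <- permutations s) \sum_(w : N.-tuple 'I_n) c w *: wprod (map V ts) w = 0.
Proof.
move=> szs c0; rewrite exchange_big /=; under eq_bigr => w _ do rewrite -scaler_sumr -/(Q w).
(* [Q'] makes [Q] a function of the content, through a chosen representative word. The linear map
   sending the monomial [m] to [Q' m] is then applied to the polynomial that vanishes by
   hypothesis. *)
pose Q' (m : 'X_{1..n}) : R := if [pick w : N.-tuple 'I_n | mword w == m] is Some w then Q w else 0.
have QE (w : N.-tuple 'I_n) : Q w = Q' (mword w).
  rewrite /Q'; case: pickP => [w'|/(_ w)]; last by rewrite eqxx.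
  by rewrite eq_sym perm_mword => /Q_perm; apply; rewrite size_tuple szs.
have : \sum_(m : 'X_{1..n < N.+1})
    (\sum_(w : N.-tuple 'I_n) c w *: wprod (nseq N genvec) w)@_m *: Q' m = 0.
  by rewrite c0 big1 // => m _; rewrite mcoeff0 scale0r.
move=> sum0; rewrite -[RHS]sum0.
under [RHS]eq_bigr => m _ do rewrite raddf_sum /= scaler_suml.
rewrite exchange_big /=; apply: eq_bigr => w _.
have wN : (mdeg (mword w) < N.+1)%N by rewrite mdeg_mword size_tuple.
rewrite wprod_nseq ?size_tuple // prodX_mword (bigD1 (BMultinom wN)) //=.
rewrite mcoeffZ mcoeffX eqxx mulr1 QE big1 ?addr0 // => m nm.
rewrite mcoeffZ mcoeffX (_ : _ == _ = false) ?mulr0 ?scale0r //.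
by apply: contraNF nm => /eqP e; apply/eqP/val_inj.
Qed.

End ShuffleSum.
End Words.

(** * Symmetric multilinear forms and powers of the Jacobian matrix *)

Section SymmetricForm.
Variables (K : fieldType) (n d : nat) (h : 'I_n -> seq 'I_n -> K).
Hypothesis h_perm : forall i w w', perm_eq w w' -> h i w = h i w'.
Local Notation R := {mpoly K[n]}.
Local Notation vec := ('I_n -> R).
Local Notation word := (seq 'I_n).
Implicit Types (w l : word) (ts us : seq vec) (i j k : 'I_n).

Definition sym_form i ts : R := \sum_(w : d.+1.-tuple 'I_n) h i w *: wprod ts w.

(** The form with the basis vector [j] in one slot; by symmetry of [h] that slot may be taken to be
    the first. *)
Definition slot_form i j us : R := \sum_(l : d.-tuple 'I_n) h i (j :: l) *: wprod us l.

Lemma perm_ins q j l : perm_eq (ins q j l) (j :: l).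
Proof. by rewrite /ins perm_catC /= perm_cons perm_catC cat_take_drop. Qed.

Lemma sym_form_ins q i y us : size us = d -> (q <= d)%N ->
  sym_form i (ins q y us) = \sum_j slot_form i j us * y j.
Proof.
move=> zus qd; rewrite /sym_form (big_tuple_ins (fun w => h i w *: wprod _ w) qd).
apply: eq_bigr => j _; rewrite /slot_form mulr_suml; apply: eq_bigr => l _.
rewrite (h_perm _ (perm_ins q j l)) wprod_ins ?size_tuple //.
by rewrite mulrC scalerAl.
Qed.

Lemma mderiv_prodX w j :
  (\prod_(i <- w) 'X_i : R)^`M(j) =
  \sum_(q < size w) (nth j w q == j)%:R * \prod_(i <- take q w ++ drop q.+1 w) 'X_i.
Proof.
elim: w => [|i w IHw]; first by rewrite big_nil big_ord0 -mpolyC1 mderivC.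
rewrite big_cons mderivM mderivXU IHw big_ord_recl /= drop0; congr (_ + _).
rewrite mulr_sumr; apply: eq_bigr => q _.
by rewrite /bump /= add1n /= big_cons mulrCA.
Qed.

(** By symmetry all [d.+1] slots give the same term in the product rule. *)
Lemma mderiv_sym_form i j :
  (sym_form i (nseq d.+1 (@genvec K n)))^`M(j) = d.+1%:R * slot_form i j (nseq d (@genvec K n)).
Proof.
rewrite /sym_form (raddf_sum (mderiv j)).
under eq_bigr => w _.
  rewrite wprod_nseq ?size_tuple // /= mderivZ mderiv_prodX size_tuple scaler_sumr.
  over.
rewrite exchange_big /= mulr_natl -[d.+1 in RHS]card_ord -sumr_const; apply: eq_bigr => q _.
have qd : (q <= d)%N by rewrite -ltnS.
rewrite (big_tuple_ins (fun w => h i w *: ((nth j w q == j)%:R *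
  \prod_(i <- take q w ++ drop q.+1 w) 'X_i)) qd).
rewrite (bigD1 j) //= [X in _ + X]big1 ?addr0 => [|k nkj].
  apply: eq_bigr => l _; have zq : size (take q l) = q by rewrite size_takel // size_tuple.
  rewrite (h_perm _ (perm_ins q j l)) /ins nth_cat zq ltnn subnn /= eqxx mul1r.
  rewrite take_size_cat // -cat_rcons drop_size_cat ?size_rcons ?zq // cat_take_drop.
  by rewrite wprod_nseq // size_tuple.
apply: big1 => l _; have zq : size (take q l) = q by rewrite size_takel // size_tuple.
by rewrite /ins nth_cat zq ltnn subnn /= (negPf nkj) mul0r scaler0.
Qed.

(** Coefficients of an entry of a product of [p] matrices [slot_form], the word being cut into [p]
    blocks of [d] letters. Keeping the entry as one multilinear form in [p * d] vectors allows
    vectors to be moved between levels. *)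
Fixpoint path_coef p i j l : K :=
  if p is p'.+1 then \sum_k h i (k :: take d l) * path_coef p' k j (drop d l)
  else (i == j)%:R.

Definition path_form p i j ts : R :=
  \sum_(l : (p * d).-tuple 'I_n) path_coef p i j l *: wprod ts l.

Lemma path_form0 i j ts : path_form 0 i j ts = (i == j)%:R.
Proof.
rewrite /path_form (bigD1 [tuple]) //= big1 ?addr0 => [|l].
  by rewrite /wprod; case: ts => [|t ts] /=; rewrite big_nil -mul_mpolyC mulr1 rmorph_nat.
by rewrite tuple0.
Qed.

Lemma path_formS p i j ts1 ts2 : size ts1 = d ->
  path_form p.+1 i j (ts1 ++ ts2) = \sum_k slot_form i k ts1 * path_form p k j ts2.
Proof.
move=> z1; rewrite /path_form.
rewrite (big_tuple_cat d (p * d) (fun l => path_coef p.+1 i j l *: wprod (ts1 ++ ts2) l)).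
rewrite /slot_form; under [RHS]eq_bigr => k _ do rewrite mulr_suml.
rewrite [RHS]exchange_big /=; apply: eq_bigr => u _.
under [RHS]eq_bigr => k _ do rewrite mulr_sumr.
rewrite [RHS]exchange_big /=; apply: eq_bigr => v _.
rewrite wprod_cat ?size_tuple // scaler_suml; apply: eq_bigr => k _.
rewrite take_size_cat ?drop_size_cat ?size_tuple //.
by rewrite -scalerAl -scalerAr scalerA.
Qed.

Lemma path_formD r p i j ts1 ts2 : size ts1 = (r * d)%N ->
  path_form (r + p) i j (ts1 ++ ts2) = \sum_k path_form r i k ts1 * path_form p k j ts2.
Proof.
elim: r i ts1 => [|r IHr] i ts1 z1.
  case: ts1 z1 => // _; rewrite (bigD1 i) //= big1 ?addr0 => [|k nki].
    by rewrite path_form0 eqxx mul1r.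
  by rewrite path_form0 eq_sym (negPf nki) mul0r.
have z : size (take d ts1) = d by rewrite size_takel // z1 mulSn leq_addr.
rewrite -(cat_take_drop d ts1) -catA addSn path_formS //.
under [RHS]eq_bigr => k _ do rewrite path_formS // mulr_suml.
rewrite [RHS]exchange_big /=; apply: eq_bigr => k _.
rewrite IHr ?size_drop ?z1 ?mulSn ?addKn // mulr_sumr.
by apply: eq_bigr => l _; rewrite mulrA.
Qed.

Definition mxiter (A : 'M[R]_n) p := iter p (mulmx A) 1%:M.

(** Each of the [p] Jacobian factors brings one [d.+1]. Nilpotency thus becomes vanishing of
    [path_form] on the diagonal, the input of [shuffle_sum_eq0]. *)
Lemma mxiter_path p :
  mxiter (Jac (fun i => sym_form i (nseq d.+1 (@genvec K n)))) p =
  \matrix_(i, j) (d.+1%:R ^+ p * path_form p i j (nseq (p * d) (@genvec K n))).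
Proof.
elim: p => [|p IHp]; first by apply/matrixP=> i j; rewrite !mxE path_form0 mul1r.
rewrite /= -/(mxiter _ p) IHp; apply/matrixP=> i j; rewrite !mxE.
rewrite mulSn nseqD path_formS ?size_nseq // mulr_sumr.
apply: eq_bigr => k _; rewrite !mxE mderiv_sym_form exprS.
by rewrite -!mulrA; congr (_ * _); rewrite mulrCA.
Qed.

Lemma path_form_homog p i j : path_form p i j (nseq (p * d) (@genvec K n)) \is (p * d).-homog.
Proof.
apply: rpred_sum => l _; apply: rpredZ; rewrite wprod_nseq ?size_tuple // prodX_mword.
by rewrite dhomogX /= mdeg_mword size_tuple.
Qed.

End SymmetricForm.

(** * Polarization of a homogeneous polynomial map *)

Section SymmetricCoefficients.
Variables (K : fieldType) (n d : nat).
Hypothesis char0 : forall k, k.+1%:R != 0 :> K.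

(** The coefficient of a monomial is spread evenly over the words with its content; their number is
    a multinomial coefficient, invertible in characteristic zero. *)
Definition sym_coef (H : 'I_n -> {mpoly K[n]}) (i : 'I_n) (w : seq 'I_n) : K :=
  (H i)@_(mword w) / #|[set u : d.+1.-tuple 'I_n | mword u == mword w]|%:R.

Lemma sym_coef_perm H i w w' : perm_eq w w' -> sym_coef H i w = sym_coef H i w'.
Proof. by rewrite /sym_coef -perm_mword => /eqP ->. Qed.

Lemma exists_mword (m : 'X_{1..n}) k : mdeg m = k -> exists w : k.-tuple 'I_n, mword w = m.
Proof.
elim: k m => [|k IHk] m mk.
  by exists [tuple]; rewrite /mword big_nil; apply/esym/eqP; rewrite -mdeg_eq0 mk.
have [|al [be [mE alE]]] := @mnm_split _ m 1; first by rewrite mk.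
have /eqP/mdeg1P[i /eqP aiE] := alE.
have [|w wE] := IHk be; first by move: mk; rewrite mE mdegD alE => -[].
by exists [tuple of i :: w]; rewrite /mword /= big_cons -/(mword w) wE mE aiE.
Qed.

Lemma sym_form_coef H i : H i \is d.+1.-homog ->
  sym_form d (sym_coef H) i (nseq d.+1 (@genvec K n)) = H i.
Proof.
move=> Hh; apply/mpolyP => m; rewrite /sym_form (raddf_sum (mcoeff m)).
under eq_bigr => w _ do rewrite wprod_nseq ?size_tuple // prodX_mword /= mcoeffZ mcoeffX.
have [md|nmd] := eqVneq (mdeg m) d.+1; last first.
  rewrite (dhomog_nemf_coeff Hh nmd) big1 // => w _.
  case: eqP => [wE|_]; last by rewrite mulr0.
  by rewrite -wE mdeg_mword size_tuple eqxx in nmd.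
have [u uE] := exists_mword md.
rewrite (bigID (fun w : d.+1.-tuple 'I_n => mword w == m)) /= [X in _ + X]big1 ?addr0; last first.
  by move=> w /negPf ->; rewrite mulr0.
pose S := [set u : d.+1.-tuple 'I_n | mword u == m].
rewrite (eq_bigr (fun=> (H i)@_m / #|S|%:R)) => [|w /eqP wE]; last first.
  by rewrite /sym_coef wE eqxx mulr1.
rewrite sumr_const -[X in _ *+ X](eq_card (A := S)) => [|w]; last by rewrite inE.
have S0 : (0 < #|S|)%N by apply/card_gt0P; exists u; rewrite inE uE.
by rewrite -[LHS]mulr_natr divfK // -(prednK S0) char0.
Qed.

End SymmetricCoefficients.

(** * Addresses, grafting and siblings along a path *)

Section Trees.
Implicit Types (t u : ptree) (a q : seq nat) (pos : seq (seq nat)).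

(** A named copy of the inner fixpoint of [vertices], so that the two agree by conversion. *)
Fixpoint forest_vertices i (s : seq ptree) : seq (seq nat) :=
  if s is c :: s' then map (cons i) (vertices c) ++ forest_vertices i.+1 s' else [::].

Fixpoint isvert t a : bool :=
  if a is i :: a' then (i < size (children t))%N && isvert (nth leaf (children t) i) a' else true.

Lemma vertices_isvert t a : a \in vertices t -> isvert t a.
Proof.
elim: a t => [|i a IHa] [x|m s] //.
have -> : vertices (GenTree.Node m s) = [::] :: forest_vertices 0 s by [].
rewrite inE /=.
have forest k r : i :: a \in forest_vertices k r ->
    (k <= i < k + size r)%N && (a \in vertices (nth leaf r (i - k))).
  elim: r k => //= c r IHr k; rewrite mem_cat => /orP[/mapP[b bc [-> ->]]|/IHr].
    by rewrite subnn /= bc leqnn andbT; lia.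
  case/andP => ki; rewrite (_ : i - k = (i - k.+1).+1)%N; last by lia.
  by move=> ->; rewrite andbT; lia.
by move=> /forest /andP[/andP[_ ->]]; rewrite subn0; apply: IHa.
Qed.

(** The addresses branch apart, neither being a prefix of the other; replacements at such addresses
    do not interfere. *)
Fixpoint incomp q q' : bool :=
  match q, q' with
  | i :: q1, j :: q1' => (i != j) || incomp q1 q1'
  | _, _ => false
  end.

Lemma incomp_sym q q' : incomp q q' = incomp q' q.
Proof. by elim: q q' => [|i q IHq] [|j q'] //=; rewrite eq_sym IHq. Qed.

Lemma subtree_replace t q u : isvert t q -> subtree (replace t q u) q = u.
Proof.
elim: q t => [|i q IHq] [x|m s] //= /andP[_ vq].
by rewrite nth_set_nth /= eqxx IHq.
Qed.

Lemma subtree_replace_incomp t q q' u :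
  incomp q q' -> subtree (replace t q u) q' = subtree t q'.
Proof.
elim: q q' t => [|i q IHq] [|j q'] [x|m s] //= nqq'.
rewrite nth_set_nth /=; case: (eqVneq j i) nqq' => [->|//].
by move=> /IHq.
Qed.

Lemma isvert_replace_incomp t q q' u :
  incomp q q' -> isvert t q' -> isvert (replace t q u) q'.
Proof.
elim: q q' t => [|i q IHq] [|j q'] [x|m s] //= nqq' /andP[js vq'].
rewrite size_set_nth leq_max js orbT nth_set_nth /=.
by case: (eqVneq j i) nqq' vq' => [->|//] /IHq; apply.
Qed.

Lemma isdcat_nth D m s i :
  is_dcat D (GenTree.Node m s) -> is_dcat D (nth leaf s i).
Proof.
move=> /= /and3P[_ _ /(all_nthP leaf) sD].
by case: (ltnP i (size s)) => [/sD|/(nth_default _) ->].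
Qed.

Lemma isdcat_subtree D t q : is_dcat D t -> is_dcat D (subtree t q).
Proof.
elim: q t => [|i q IHq] [x|m s] //= tD; apply: IHq; first by rewrite nth_nil.
exact: isdcat_nth tD.
Qed.

Lemma isdcat_replace D t q u :
  is_dcat D t -> isvert t q -> is_dcat D u -> is_dcat D (replace t q u).
Proof.
elim: q t => [|i q IHq] [x|m s] //= tD /andP[si vq] uD.
have tiD := isdcat_nth i tD; case/and3P: tD => -> /eqP sD /(all_nthP leaf) allD /=.
rewrite size_set_nth (maxn_idPr si) sD eqxx /=; apply/(all_nthP leaf) => j.
rewrite size_set_nth (maxn_idPr si) nth_set_nth /= => sj.
by case: eqP => _; [apply: IHq | apply: allD].
Qed.

Lemma subtree_graft_incomp t l q :
  all (fun x => incomp x.1 q) l -> subtree (graft t l) q = subtree t q.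
Proof.
by elim: l t => //= x l IHl t /andP[xq /IHl ->]; rewrite subtree_replace_incomp.
Qed.

Lemma isvert_graft_incomp t (l : seq (seq nat * ptree)) q :
  all (fun x => incomp x.1 q) l -> isvert t q -> isvert (graft t l) q.
Proof.
by elim: l t => //= x l IHl t /andP[xq lq] tq; apply: IHl lq _; apply: isvert_replace_incomp.
Qed.

Lemma all_zip1 (T S : Type) (P : pred T) (s : seq T) (r : seq S) :
  all P s -> all (fun x => P x.1) (zip s r).
Proof. by elim: s r => [|x s IHs] [|y r] //= /andP[-> Ps]; apply: IHs. Qed.

Lemma subtrees_graft t pos (ts : seq ptree) :
  size ts = size pos -> pairwise incomp pos -> all (isvert t) pos ->
  map (subtree (graft t (zip pos ts))) pos = ts.
Proof.
elim: pos ts t => [|q pos IHpos] [|u ts] t //= [zts] /andP[qpos ppos] /andP[tq tpos].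
rewrite subtree_graft_incomp ?subtree_replace //; last first.
  by apply: (all_zip1 (P := incomp^~ q)); apply: sub_all qpos => q'; rewrite incomp_sym.
congr (_ :: _); apply: IHpos => //.
apply/allP => q' q'pos; apply: isvert_replace_incomp; first exact: (allP qpos).
exact: (allP tpos).
Qed.

Lemma isdcat_graft D t pos (ts : seq ptree) :
  pairwise incomp pos -> all (isvert t) pos -> is_dcat D t -> all (is_dcat D) ts ->
  is_dcat D (graft t (zip pos ts)).
Proof.
elim: pos ts t => [|q pos IHpos] [|u ts] t //= /andP[qpos ppos] /andP[tq tpos] tD /andP[uD tsD].
apply: IHpos => //; last exact: isdcat_replace.
apply/allP => q' q'pos; apply: isvert_replace_incomp; first exact: (allP qpos).
exact: (allP tpos).
Qed.

(** With [p] the full height, the siblings along the whole path from the root are listed by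
    increasing height, so the last [p] levels form a final block. *)
Definition all_siblings D a := sibling_positions D (size a) a.

Definition upper_siblings D p a :=
  flatten [seq [seq rcons (take m a) j | j <- iota 0 D & j != nth 0%N a m]
          | m <- iota 0 (size a - p)].

Lemma all_siblings_split D p a : (p <= size a)%N ->
  all_siblings D a = upper_siblings D p a ++ sibling_positions D p a.
Proof.
move=> pa; rewrite /all_siblings /sibling_positions subnn.
have -> : iota 0 (size a) = iota 0 (size a - p) ++ iota (size a - p) p by rewrite -iotaD subnK.
by rewrite map_cat flatten_cat.
Qed.

Lemma all_siblings_cons D i a :
  all_siblings D (i :: a) =
  [seq [:: j] | j <- iota 0 D & j != i] ++ map (cons i) (all_siblings D a).
Proof.
rewrite /all_siblings /sibling_positions /= !subnn /=; congr (_ ++ _).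
rewrite -[1%N]/(1 + 0)%N iotaDl -map_comp map_flatten -map_comp.
by congr flatten; apply: eq_map => m /=; rewrite -map_comp.
Qed.

Lemma iota_neq d (q : nat) : (q <= d)%N ->
  [seq j <- iota 0 d.+1 | j != q] = iota 0 q ++ iota q.+1 (d - q).
Proof.
move=> qd; rewrite -[d.+1](_ : q + (d - q).+1 = _)%N; last by lia.
rewrite iotaD filter_cat /= add0n eqxx /=; congr (_ ++ _); apply/all_filterP/allP => j.
  by rewrite mem_iota; lia.
by rewrite mem_iota; lia.
Qed.

Lemma size_iota_neq d (q : nat) : (q <= d)%N -> size [seq j <- iota 0 d.+1 | j != q] = d.
Proof. by move=> qd; rewrite iota_neq // size_cat !size_iota; lia. Qed.

Lemma ins_nth T (x0 : T) (s : seq T) d (q : nat) : size s = d.+1 -> (q <= d)%N ->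
  ins q (nth x0 s q) [seq nth x0 s j | j <- iota 0 d.+1 & j != q] = s.
Proof.
move=> sd qd; rewrite iota_neq // map_cat map_nth_iota0 ?map_nth_iota ?sd //; last by lia.
have zq : size (take q s) = q by rewrite size_takel // sd; lia.
rewrite /ins take_size_cat // drop_size_cat // (@take_oversize _ (d - q)) ?size_drop ?sd; last by lia.
by rewrite -drop_nth ?cat_take_drop // sd.
Qed.

Lemma size_all_siblings d a : all (fun i => i <= d)%N a ->
  size (all_siblings d.+1 a) = (size a * d)%N.
Proof.
elim: a => [|i a IHa] //= /andP[id ad].
by rewrite all_siblings_cons size_cat !size_map size_iota_neq // IHa.
Qed.

Lemma size_sibling_positions d p a : all (fun i => i <= d)%N a -> (p <= size a)%N ->
  size (sibling_positions d.+1 p a) = (p * d)%N.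
Proof.
move=> /allP ad pa; rewrite size_flatten /shape -map_comp sumnE big_map big_seq.
rewrite (eq_bigr (fun=> d)) => [|m]; last first.
  rewrite mem_iota subnK // => /andP[_ mp] /=.
  by rewrite size_map size_iota_neq //; apply: ad; rewrite mem_nth.
by rewrite -big_seq big_const_seq iter_addn_0 count_predT size_iota mulnC.
Qed.

Lemma incomp_all_siblings D a :
  pairwise incomp (all_siblings D a) && all (incomp^~ a) (all_siblings D a).
Proof.
elim: a => [|i a /andP[IHp IHa]] //.
rewrite all_siblings_cons pairwise_cat !all_cat !pairwise_map !all_map.
apply/andP; split; first apply/and3P; first split.
- apply/allrelP => _ _ /mapP[j + ->] /mapP[q _ ->] /=.
  by rewrite mem_filter => /andP[->].
- have : uniq [seq j <- iota 0 D | j != i] by rewrite filter_uniq ?iota_uniq.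
  by rewrite uniq_pairwise; apply: sub_pairwise => j k /=; rewrite orbF.
- by apply: sub_pairwise IHp => q q' /=; rewrite eqxx.
apply/andP; split; first by apply/allP => j /=; rewrite mem_filter => /andP[->].
by apply: sub_all IHa => q /=; rewrite eqxx.
Qed.

Lemma isvert_le d t a : is_dcat d.+1 t -> isvert t a -> all (fun i => i <= d)%N a.
Proof.
elim: a t => [|i a IHa] [x|m s] //= tD /andP[si va].
have := IHa _ (isdcat_nth i tD) va => ->.
by case/and3P: tD => _ /eqP sd _; rewrite -ltnS -sd si.
Qed.

Lemma isvert_all_siblings D t a : is_dcat D t -> isvert t a -> all (isvert t) (all_siblings D a).
Proof.
elim: a t => [|i a IHa] [x|m s] //= tD /andP[si va].
rewrite all_siblings_cons all_cat !all_map; apply/andP; split.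
  apply/allP => j; rewrite mem_filter mem_iota /= => /andP[_ jD].
  by case/and3P: tD => _ /eqP -> _; rewrite jD.
by apply: sub_all (IHa _ (isdcat_nth i tD) va) => q /= ->; rewrite si.
Qed.

Lemma sumn_map_ins T (f : T -> nat) (k : nat) x (s : seq T) :
  sumn (map f (ins k x s)) = (f x + sumn (map f s))%N.
Proof. by rewrite /ins map_cat sumn_cat /= addnCA -sumn_cat -map_cat cat_take_drop. Qed.

(** The path contributes its [size a] proper ancestors of [a]. A shuffle only permutes terms of the
    middle sum, so the number of internal vertices is preserved. *)
Lemma internal_path d t a : is_dcat d.+1 t -> isvert t a ->
  internal t = (size a + sumn [seq internal (subtree t q) | q <- all_siblings d.+1 a]
                + internal (subtree t a))%N.
Proof.
elim: a t => [|i a IHa] [x|m s] //= tD /andP[si va].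
have IH := IHa _ (isdcat_nth i tD) va; case/and3P: tD => _ /eqP sd _.
have id : (i <= d)%N by rewrite -ltnS -sd.
rewrite all_siblings_cons -{1}(ins_nth leaf sd id) sumn_map_ins IH.
rewrite map_cat sumn_cat; set A := sumn (map internal _).
set X := sumn [seq internal _ | q <- _]; set Y := internal _.
transitivity ((size a).+1 + (A + X) + Y)%N; first by lia.
by congr (_ + (_ + _) + _)%N; rewrite /A /X -!map_comp.
Qed.

End Trees.

(** * Shuffle classes as families of distinct arrangements *)

Section Shuffles.
Variables (d p : nat).
Implicit Types (T : ptree) (v : seq nat) (ts : seq ptree).

(** The shuffled positions are incomparable with one another, with the upper siblings and with [v],
    so each graft acts independently and the other data along the path are untouched. *)
Lemma graft_siblings T v ts : is_dcat d.+1 T -> isvert T v -> (p <= size v)%N ->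
  let pos := sibling_positions d.+1 p v in
  ts \in permutations (map (subtree T) pos) ->
  [/\ is_dcat d.+1 (graft T (zip pos ts)), isvert (graft T (zip pos ts)) v,
      map (subtree (graft T (zip pos ts))) (upper_siblings d.+1 p v)
        = map (subtree T) (upper_siblings d.+1 p v),
      map (subtree (graft T (zip pos ts))) pos = ts &
      subtree (graft T (zip pos ts)) v = subtree T v].
Proof.
move=> TD Tv pv pos; rewrite mem_permutations => tsP.
have zts : size ts = size pos by rewrite (perm_size tsP) size_map.
have /andP[+ av] := incomp_all_siblings d.+1 v.
have := isvert_all_siblings TD Tv.
move: av; rewrite (all_siblings_split _ pv) -/pos !all_cat pairwise_cat.
move=> /andP[_ posv] /andP[_ Tpos] /and3P[/allrelP up _ pp].
have posv' : all (fun x => incomp x.1 v) (zip pos ts) by exact: (all_zip1 (P := incomp^~ v)).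
split.
- apply: isdcat_graft => //; apply/allP => u; rewrite (perm_mem tsP) => /mapP[q _ ->].
  exact: isdcat_subtree.
- exact: isvert_graft_incomp.
- apply/eq_in_map => q qup; apply: subtree_graft_incomp.
  apply: (all_zip1 (P := incomp^~ q)); apply/allP => q' q'pos.
  by rewrite incomp_sym up.
- exact: subtrees_graft.
- exact: subtree_graft_incomp.
Qed.

(** The arrangement [ts] can be read off the grafted tree at the sibling positions, so [undup]
    removes nothing and class sums are sums over arrangements. *)
Lemma shuffle_classE T v : is_dcat d.+1 T -> isvert T v -> (p <= size v)%N ->
  let pos := sibling_positions d.+1 p v in
  shuffle_class d.+1 p T v =
  [seq graft T (zip pos ts) | ts <- permutations (map (subtree T) pos)].
Proof.
move=> TD Tv pv pos; rewrite /shuffle_class undup_id // map_inj_in_uniq ?permutations_uniq //.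
move=> ts1 ts2 /(graft_siblings TD Tv pv)[_ _ _ e1 _] /(graft_siblings TD Tv pv)[_ _ _ e2 _] eqg.
by rewrite -[LHS]e1 -[RHS]e2 eqg.
Qed.

Lemma shuffle_class_catalan k T v T' : catalan d.+1 k T -> isvert T v -> (p <= size v)%N ->
  T' \in shuffle_class d.+1 p T v -> catalan d.+1 k T'.
Proof.
move=> /andP[TD /eqP <-] Tv pv; rewrite shuffle_classE // => /mapP[ts tsP ->].
have [T'D T'v up ptsE vE] := graft_siblings TD Tv pv tsP.
apply/andP; split=> //; apply/eqP.
rewrite (internal_path T'D T'v) (internal_path TD Tv) vE (all_siblings_split _ pv).
have comp t qs : [seq internal (subtree t q) | q <- qs] = map internal (map (subtree t) qs).
  by rewrite -map_comp.
congr (_ + _ + _)%N; rewrite !map_cat !sumn_cat !comp up ptsE.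
by congr (_ + _)%N; apply/perm_sumn/perm_map; rewrite -mem_permutations.
Qed.

End Shuffles.

(** * Tree polynomials and their sums over shuffle classes *)

Section TreePolynomials.
Variables (K : fieldType) (n d : nat) (h : 'I_n -> seq 'I_n -> K).
Hypothesis h_perm : forall i w w', perm_eq w w' -> h i w = h i w'.
Local Notation R := {mpoly K[n]}.

Fixpoint tree_poly (t : ptree) : 'I_n -> R :=
  match t with
  | GenTree.Leaf _ => @genvec K n
  | GenTree.Node _ s => fun i => sym_form d h i (map tree_poly s)
  end.

(** By multilinearity each level of the path applies the [slot_form] matrix of its [d] siblings to
    the vector of the next vertex. *)
Lemma tree_poly_path t a i : is_dcat d.+1 t -> isvert t a ->
  tree_poly t i =
  \sum_j path_form d h (size a) i j [seq tree_poly (subtree t q) | q <- all_siblings d.+1 a]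
         * tree_poly (subtree t a) j.
Proof.
elim: a t i => [|i0 a IHa] t i.
  move=> _ _; rewrite (bigD1 i) //= big1 ?addr0 => [|j nji].
    by rewrite path_form0 eqxx mul1r.
  by rewrite path_form0 eq_sym (negPf nji) mul0r.
case: t => [x|m s] // tD /andP[si va].
have IH j := IHa _ j (isdcat_nth i0 tD) va; case/and3P: tD => _ /eqP sd _.
have id : (i0 <= d)%N by rewrite -ltnS -sd.
rewrite [LHS]/= -{1}(ins_nth leaf sd id) /ins map_cat map_cons map_take map_drop.
rewrite sym_form_ins //; last by rewrite !size_map size_iota_neq.
rewrite all_siblings_cons map_cat.
under [RHS]eq_bigr => j _.
  rewrite path_formS; last by rewrite !size_map size_iota_neq.
  rewrite mulr_suml; over.
rewrite [RHS]exchange_big /=; apply: eq_bigr => k _.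
rewrite IH mulr_sumr; apply: eq_bigr => j _.
by rewrite mulrA -!map_comp.
Qed.

Lemma sum_shuffle_class_eq0 p T v i :
  is_dcat d.+1 T -> isvert T v -> (p <= size v)%N ->
  (forall i j, path_form d h p i j (nseq (p * d) (@genvec K n)) = 0) ->
  \sum_(T' <- shuffle_class d.+1 p T v) tree_poly T' i = 0.
Proof.
move=> TD Tv pv nil; rewrite shuffle_classE // big_map big_seq.
set pos := sibling_positions _ _ _.
have vd := isvert_le TD Tv.
have zpos : size pos = (p * d)%N by rewrite size_sibling_positions.
have zup : size (upper_siblings d.+1 p v) = ((size v - p) * d)%N.
  have := size_all_siblings vd; rewrite (all_siblings_split _ pv) size_cat zpos mulnBl.
  by move=> <-; rewrite addnK.
(* [A] collects the levels above the last [p] and the subtree at [v], both constant on the class;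
   only the remaining [path_form] depends on the arrangement. *)
pose A j k := path_form d h (size v - p) i k
  [seq tree_poly (subtree T q) | q <- upper_siblings d.+1 p v] * tree_poly (subtree T v) j.
have comp t qs : [seq tree_poly (subtree t q) | q <- qs] = map tree_poly (map (subtree t) qs).
  by rewrite -map_comp.
under eq_bigr => ts tsP.
  have [T'D T'v up ptsE vE] := graft_siblings TD Tv pv tsP.
  rewrite (tree_poly_path i T'D T'v) vE (all_siblings_split _ pv) map_cat.
  rewrite -{1}(subnK pv) !comp up ptsE -comp.
  under eq_bigr => j _.
    rewrite path_formD ?size_map // mulr_suml.
    under eq_bigr => k _ do rewrite mulrAC -/(A j k).
    over.
  over.
rewrite -big_seq exchange_big big1 //= => j _.
rewrite exchange_big big1 //= => k _; rewrite -mulr_sumr.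
have zs : size (map (subtree T) pos) = (p * d)%N by rewrite size_map.
by have := shuffle_sum_eq0 tree_poly zs (nil k j); rewrite /path_form => ->; rewrite mulr0.
Qed.

End TreePolynomials.

(** * Finite lists of trees *)

Section Enumeration.

Fixpoint seqs_of (T : Type) k (L : seq T) : seq (seq T) :=
  if k is k'.+1 then [seq x :: l | x <- L, l <- seqs_of k' L] else [:: [::]].

Lemma mem_seqs_of (T : eqType) k (L s : seq T) :
  (s \in seqs_of k L) = (size s == k) && all (mem L) s.
Proof.
elim: k s => [|k IHk] [|x s] //=; first by apply/allpairsP => -[[y l] []].
apply/allpairsP/idP => [[[y l] /= [yL]]|/and3P[sk xL sL]].
  by rewrite IHk => /andP[/eqP <- lL] [-> ->]; rewrite eqxx yL.
by exists (x, s); split; rewrite //= IHk sL andbT.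
Qed.

Lemma seqs_of_uniq (T : eqType) k (L : seq T) : uniq L -> uniq (seqs_of k L).
Proof.
move=> uL; elim: k => //= k IHk; apply: allpairs_uniq => // -[x l] [x' l'] _ _ /= [-> ->] //.
Qed.

(** Bounding the depth, not the number of internal vertices, makes the decomposition at the root
    exact, as the recursion [tree_sumS] requires. *)
Fixpoint trees_le D m : seq ptree :=
  leaf :: if m is m'.+1 then map (GenTree.Node 0%N) (seqs_of D (trees_le D m')) else [::].

Lemma trees_le_uniq D m : uniq (trees_le D m).
Proof.
elim: m => //= m IHm; rewrite map_inj_uniq ?seqs_of_uniq ?andbT //; last by move=> s s' [].
by apply/mapP => -[].
Qed.

Lemma trees_le_isdcat D m t : t \in trees_le D m -> is_dcat D t.
Proof.
elim: m t => [|m IHm] t; first by rewrite inE => /eqP ->.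
rewrite inE => /orP[/eqP -> //|/mapP[s + ->]].
by rewrite mem_seqs_of /= => /andP[-> /allP sL]; apply/allP => x /sL /IHm.
Qed.

Lemma leq_sumn (s : seq nat) x : x \in s -> (x <= sumn s)%N.
Proof. by elim: s => //= y s IHs; rewrite inE => /orP[/eqP -> |/IHs]; lia. Qed.

(** The depth never exceeds the number of internal vertices, so [catalans D k] can be cut out of
    [trees_le D k]. *)
Lemma mem_trees_le D m t : is_dcat D t -> (internal t <= m)%N -> t \in trees_le D m.
Proof.
elim: m t => [|m IHm] [[]|k s] //= /and3P[/eqP -> sD /allP allD]; rewrite ltnS => sm.
rewrite inE; apply/orP; right; apply: map_f; rewrite mem_seqs_of sD; apply/allP => x xs.
by apply: IHm (allD _ xs) (leq_trans _ sm); apply/leq_sumn/map_f.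
Qed.

Definition catalans D k := [seq t <- trees_le D k | internal t == k].

Lemma catalans_uniq D k : uniq (catalans D k).
Proof. by rewrite filter_uniq ?trees_le_uniq. Qed.

Lemma mem_catalans D k m t : (k <= m)%N ->
  (t \in [seq t <- trees_le D m | internal t == k]) = catalan D k t.
Proof.
move=> km; rewrite mem_filter andbC /catalan; case: eqP => [tk|]; last by rewrite !andbF.
rewrite !andbT; apply/idP/idP => [/trees_le_isdcat //|tD].
by rewrite mem_trees_le ?tk.
Qed.

Lemma perm_catalans D k m : (k <= m)%N ->
  perm_eq [seq t <- trees_le D m | internal t == k] (catalans D k).
Proof.
move=> km; apply: uniq_perm; rewrite ?filter_uniq ?trees_le_uniq // => t.
by rewrite mem_catalans // mem_catalans.
Qed.

End Enumeration.

(** * The filtration of polynomials by lowest degree *)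

Section Order.
Variables (K : fieldType) (n : nat).
Local Notation R := {mpoly K[n]}.
Implicit Types p q : R.

Definition ord_ge m p := forall mu : 'X_{1..n}, (mdeg mu < m)%N -> p@_mu = 0.

Lemma ord_ge_leq m m' p : (m <= m')%N -> ord_ge m' p -> ord_ge m p.
Proof. by move=> mm' pm mu mum; apply/pm/(leq_trans mum). Qed.

Lemma ord_ge0 m : ord_ge m 0.
Proof. by move=> mu _; rewrite mcoeff0. Qed.

Lemma ord_geD m p q : ord_ge m p -> ord_ge m q -> ord_ge m (p + q).
Proof. by move=> pm qm mu mum; rewrite mcoeffD pm // qm // addr0. Qed.

Lemma ord_geN m p : ord_ge m p -> ord_ge m (- p).
Proof. by move=> pm mu mum; rewrite mcoeffN pm // oppr0. Qed.

Lemma ord_geZ m c p : ord_ge m p -> ord_ge m (c *: p).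
Proof. by move=> pm mu mum; rewrite mcoeffZ pm // mulr0. Qed.

Lemma ord_geM a b p q : ord_ge a p -> ord_ge b q -> ord_ge (a + b) (p * q).
Proof.
move=> pa qb mu muab; rewrite mcoeffM big1 // => -[k1 k2] /= /eqP muE.
have [k1a|k1a] := ltnP (mdeg (k1 : 'X_{1..n})) a; first by rewrite pa // mul0r.
rewrite qb ?mulr0 // -(ltn_add2l (mdeg (k1 : 'X_{1..n}))) -mdegD -muE.
by apply: leq_trans muab _; rewrite leq_add2r.
Qed.

Lemma ord_ge_sum m (I : eqType) (r : seq I) (P : pred I) (F : I -> R) :
  (forall x, x \in r -> P x -> ord_ge m (F x)) -> ord_ge m (\sum_(x <- r | P x) F x).
Proof.
move=> Fm; rewrite big_seq_cond; apply: (big_ind (ord_ge m)) => [||x /andP[]]; first exact: ord_ge0.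
  exact: ord_geD.
exact: Fm.
Qed.

Lemma ord_geX i : ord_ge 1 ('X_i : R).
Proof.
move=> mu; rewrite ltnS leqn0 mdeg_eq0 => /eqP ->.
by rewrite mcoeffX -[_ == _]/(U_(i)%MM == 0%MM) mnm1_eq0.
Qed.

Lemma ord_ge_eq0 p : (forall m, ord_ge m p) -> p = 0.
Proof. by move=> pm; apply/mpolyP => mu; rewrite mcoeff0 (pm (mdeg mu).+1). Qed.

(** Substituting polynomials without constant term leaves the constant term of [p] unchanged. *)
Lemma ord_ge_msubst (F : 'I_n -> R) p :
  (forall i, ord_ge 1 (F i)) -> ord_ge 1 p -> ord_ge 1 (p \mS F).
Proof.
move=> F1 p1 mu; rewrite ltnS leqn0 mdeg_eq0 => /eqP ->.
rewrite -(p1 0%MM); last by rewrite mdeg0.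
elim/mpoly_ring_ind: p {p1} => [c|i|p q Ep Eq|p q Ep Eq].
- by rewrite msubstC.
- by rewrite msubstX F1 ?mdeg0 // ord_geX ?mdeg0.
- by rewrite rmorphD !mcoeffD Ep Eq.
- by rewrite rmorphM !rmorphM /= Ep Eq.
Qed.

End Order.

(** * The polynomial inverse obtained from tree sums *)

Section Inverse.
Variables (K : fieldType) (n d : nat) (h : 'I_n -> seq 'I_n -> K).
Local Notation R := {mpoly K[n]}.
Local Notation vec := ('I_n -> R).
Local Notation E := (tree_poly d h).
Local Notation gen := (@genvec K n).
Hypothesis d_gt0 : (0 < d)%N.
Implicit Types (u v : vec) (i : 'I_n).

Lemma ord_ge_wprod (I : Type) (f : I -> vec) (o : I -> nat) (s : seq I) w :
  size s = size w -> (forall x i, ord_ge (o x) (f x i)) ->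
  ord_ge (sumn (map o s)) (wprod (map f s) w).
Proof.
move=> + fo; elim: s w => [|x s IHs] [|i w] //= => -[zw].
by rewrite wprod_cons; apply: ord_geM => //; apply: IHs.
Qed.

(** Telescoping replaces one factor at a time, and each of the other [(size w).-1] factors has order
    at least 1. *)
Lemma ord_ge_prod_sub m u v (w : seq 'I_n) :
  (forall i, ord_ge 1 (u i)) -> (forall i, ord_ge 1 (v i)) ->
  (forall i, ord_ge m (u i - v i)) ->
  ord_ge (m + (size w).-1) (\prod_(i <- w) u i - \prod_(i <- w) v i).
Proof.
move=> u1 v1 uv; elim: w => [|i w IHw]; first by rewrite !big_nil subrr; apply: ord_ge0.
rewrite !big_cons /=; set P := \prod_(j <- w) u j; set Q := \prod_(j <- w) v j.
have -> : u i * P - v i * Q = (u i - v i) * P + v i * (P - Q) by ring.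
apply: ord_geD.
  apply: ord_geM => //; rewrite /P; elim: w {IHw P Q} => [|j w IHw]; first by move=> mu.
  by rewrite big_cons; apply: (@ord_geM _ _ 1).
by apply: ord_ge_leq (ord_geM (v1 i) IHw); move: (size w) => x; lia.
Qed.

(** Since [0 < d], the form is a contraction for the degree filtration; both compositions with the
    inverse are settled by this gain. *)
Lemma ord_ge_form_sub m u v i :
  (forall i, ord_ge 1 (u i)) -> (forall i, ord_ge 1 (v i)) ->
  (forall i, ord_ge m (u i - v i)) ->
  ord_ge (m + d) (sym_form d h i (nseq d.+1 u) - sym_form d h i (nseq d.+1 v)).
Proof.
move=> u1 v1 uv; rewrite /sym_form -sumrB; apply: ord_ge_sum => w _ _.
rewrite -scalerBr !wprod_nseqE ?size_tuple //; apply: ord_geZ.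
by have := @ord_ge_prod_sub m u v w u1 v1 uv; rewrite size_tuple.
Qed.

Lemma msubst_form i (G F : vec) :
  sym_form d h i (nseq d.+1 G) \mS F = sym_form d h i (nseq d.+1 (fun j => G j \mS F)).
Proof.
rewrite /sym_form msubst_sum; apply: eq_bigr => w _.
rewrite !wprod_nseqE ?size_tuple // -mul_mpolyC rmorphM /= msubstC mul_mpolyC.
by rewrite rmorph_prod.
Qed.

Lemma sum_wprod_seqs_of (T : Type) (f : T -> vec) (L : seq T) (w : seq 'I_n) k : size w = k ->
  \sum_(ts <- seqs_of k L) wprod (map f ts) w = \prod_(i <- w) \sum_(t <- L) f t i.
Proof.
move=> <-; elim: w => [|j w IHw] /=; first by rewrite big_seq1 /wprod !big_nil.
rewrite big_allpairs_dep /= big_cons -IHw mulr_suml; apply: eq_bigr => t _.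
by rewrite mulr_sumr; apply: eq_bigr => l _; rewrite wprod_cons.
Qed.

Definition tree_sum m : vec := fun i => \sum_(t <- trees_le d.+1 m) E t i.

Lemma tree_sumS m i :
  tree_sum m.+1 i = 'X_i + sym_form d h i (nseq d.+1 (tree_sum m)).
Proof.
rewrite /tree_sum [trees_le _ _.+1]/= big_cons big_map; congr (_ + _).
rewrite /sym_form exchange_big; apply: eq_bigr => w _; rewrite -scaler_sumr; congr (_ *: _).
rewrite wprod_nseqE ?size_tuple //.
by rewrite -(sum_wprod_seqs_of _ _ (size_tuple w)); apply: eq_bigr.
Qed.

Lemma ord_ge_tree m t i : t \in trees_le d.+1 m -> ord_ge (internal t).+1 (E t i).
Proof.
elim: m t i => [|m IHm] t i; first by rewrite inE => /eqP ->; apply: ord_geX.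
rewrite inE => /orP[/eqP -> |/mapP[s + ->]]; first exact: ord_geX.
rewrite mem_seqs_of => /andP[/eqP sd /allP sm] /=.
apply: ord_ge_sum => w _ _; apply: ord_geZ.
(* [ord_ge_wprod] asks for a bound at every tree, so [E] is replaced by zero off the list. *)
pose f t : vec := if t \in trees_le d.+1 m then E t else fun=> 0.
rewrite (_ : map E s = map f s); last first.
  apply/eq_in_map => x xs; have xm : x \in trees_le d.+1 m := sm _ xs.
  by rewrite /f xm.
(* The [d.+1] children add [d.+1] to the internal vertices below the root, while the claim needs 2
   more than these; [0 < d] closes the gap. *)
apply: (@ord_ge_leq _ _ _ (sumn (map (fun t => (internal t).+1) s))).
  have -> : sumn [seq (internal t).+1 | t <- s] = (sumn [seq internal t | t <- s] + size s)%N.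
    by elim: (s) => //= x r ->; lia.
  by rewrite sd; move: (sumn _) => x; lia.
apply: ord_ge_wprod => [|x j]; first by rewrite sd size_tuple.
by rewrite /f; case: ifP => [/IHm //|_]; apply: ord_ge0.
Qed.

Lemma inverse_of_tree_sums k0 :
  (forall k i, (k0 <= k)%N -> \sum_(t <- catalans d.+1 k) E t i = 0) ->
  aut (fun i => 'X_i - sym_form d h i (nseq d.+1 gen)).
Proof.
move=> vanish; pose Gk k : vec := fun i => \sum_(t <- catalans d.+1 k) E t i.
pose G : vec := fun i => \sum_(k < k0) Gk k i.
have Gk1 k i : ord_ge 1 (Gk k i).
  apply: ord_ge_sum => t; rewrite mem_filter => /andP[_ tk] _.
  exact: ord_ge_leq (ord_ge_tree i tk).
have G1 i : ord_ge 1 (G i) by apply: ord_ge_sum.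
have S1 m i : ord_ge 1 (tree_sum m i).
  by apply: ord_ge_sum => t tm _; apply: ord_ge_leq (ord_ge_tree i tm).
(* In [tree_sum m], trees with at most [m] internal vertices form complete sets [catalans], whose
   sums vanish from [k0] on; the other trees have order above [m]. *)
have SG m i : (k0 <= m)%N -> ord_ge m (tree_sum m i - G i).
  move=> k0m; rewrite /tree_sum (bigID (fun t => internal t < m.+1)%N) /=.
  rewrite (_ : \sum_(t <- _ | _) _ = G i).
    rewrite addrAC subrr add0r; apply: ord_ge_sum => t tm; rewrite -leqNgt => mt.
    by apply: ord_ge_leq (ord_ge_tree i tm); lia.
  transitivity (\sum_(k < m.+1) Gk k i).
    under [RHS]eq_bigr => k _.
      rewrite /Gk -(perm_big _ (perm_catalans d.+1 (leq_ord k))) big_filter big_mkcond /=.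
      over.
    rewrite exchange_big big_mkcond /=; apply: eq_bigr => t _.
    case: ifP => [tm|/negbT tm]; last first.
      rewrite big1 // => k _; case: eqP => // tk.
      by rewrite tk ltn_ord in tm.
    rewrite (bigD1 (Ordinal tm)) //= eqxx big1 ?addr0 // => k nk.
    by case: eqP => // tk; case/eqP: nk; apply/val_inj; rewrite /= tk.
  rewrite /G -(big_mkord xpredT (Gk^~ i)) (@big_cat_nat _ _ _ k0) //=; last exact: ltnW.
  rewrite big_mkord [X in _ + X]big_nat_cond [X in _ + X]big1 ?addr0 // => k /andP[/andP[k0k _] _].
  exact: vanish.
(* [G] agrees with the tree sums to arbitrarily high order, so the recursion [tree_sumS] becomes a
   fixed-point equation for [G]. *)
have GE i : G i = 'X_i + sym_form d h i (nseq d.+1 G).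
  apply/eqP; rewrite -subr_eq0; apply/eqP/ord_ge_eq0 => m.
  pose m' := maxn m k0.
  rewrite -[X in ord_ge _ X](subrKA (tree_sum m'.+1 i)) -opprB.
  apply: ord_geD; first apply: ord_geN.
    by apply: ord_ge_leq (SG m'.+1 i _); lia.
  rewrite tree_sumS opprD addrACA subrr add0r.
  apply: (@ord_ge_leq _ _ _ (m' + d)); first by lia.
  by apply: ord_ge_form_sub => // j; apply: SG; lia.
pose F i : R := 'X_i - sym_form d h i (nseq d.+1 gen).
have F1 i : ord_ge 1 (F i).
  apply: ord_geD; first exact: ord_geX.
  apply/ord_geN/ord_ge_sum => w _ _; apply: ord_geZ; rewrite wprod_nseqE ?size_tuple //.
  case: w => -[|j w] //= zw; rewrite big_cons.
  by apply: (@ord_geM _ _ 1 0) => //; apply: ord_geX.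
exists G; split=> i; first rewrite mmapB msubst_form msubstX {1}GE.
  rewrite (_ : sym_form _ _ _ (nseq _ (fun j => _)) = sym_form d h i (nseq d.+1 G)) ?addrK //.
  rewrite /sym_form; apply: eq_bigr => w _; rewrite !wprod_nseqE ?size_tuple //.
  by congr (_ *: _); apply: eq_bigr => j _; rewrite msubstX.
(* Substituting [F] into the fixed-point equation gives L - X = H(L) - H(X), and the contraction
   raises the order of L - X without bound. *)
pose L j : R := G j \mS F.
have LE j : L j - 'X_j = sym_form d h j (nseq d.+1 L) - sym_form d h j (nseq d.+1 gen).
  rewrite {1}/L GE mmapD msubst_form -/L msubstX /F.
  by rewrite addrAC [X in X + _ = _]addrAC subrr add0r addrC.
apply/eqP; rewrite -subr_eq0 -/(L i); apply/eqP/ord_ge_eq0 => m.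
elim: m i => [|m IHm] i; first by move=> mu.
rewrite LE; apply: (@ord_ge_leq _ _ _ (m + d)); first by lia.
apply: ord_ge_form_sub => // j; last exact: ord_geX.
exact: ord_ge_msubst.
Qed.

End Inverse.

(** * Vanishing of the sums over all trees with [k] internal vertices *)

Section Chain.
Variables (K : fieldType) (phi : {rmorphism Real -> K}).
Variables (n d p : nat) (h : 'I_n -> seq 'I_n -> K).
Hypothesis h_perm : forall i w w', perm_eq w w' -> h i w = h i w'.
Hypothesis path_eq0 :
  forall i j, path_form d h p i j (nseq (p * d) (@genvec K n)) = 0.

(* Averaging [tree_poly] over the uniform law and then taking one step of the chain gives, by
   stationarity, the same average; but each step replaces it by averages over shuffle classes. *)
Lemma sum_catalans_eq0 k (P : ptree -> seq nat -> Real) i :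
  shuffle_chain_family d.+1 p k P -> uniform_stationary d.+1 p k P ->
  \sum_(t <- catalans d.+1 k) tree_poly d h t i = 0.
Proof.
move=> chain stat; set s := catalans d.+1 k.
have sE T : (T \in s) = catalan d.+1 k T by exact: mem_catalans.
have stat_s := stat s (catalans_uniq _ _) sE.
have [s0|s_gt0] := posnP (size s); first by rewrite (size0nil s0) big_nil.
have N0 : phi (size s)%:R^-1 != 0.
  by rewrite fmorph_eq0 invr_eq0 Num.Theory.pnatr_eq0 -lt0n.
suff sum0 : phi (size s)%:R^-1 *: \sum_(t <- s) tree_poly d h t i = 0.
  by move/eqP: sum0; rewrite scaler_eq0 (negPf N0) => /eqP.
rewrite scaler_sumr big_seq.
under eq_bigr => T' T's do rewrite -(stat_s T' T's) rmorph_sum scaler_suml.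
rewrite -big_seq exchange_big big_seq big1 //= => T; rewrite sE => Tcat.
have [Pv _] := chain T Tcat; have /andP[TD _] := Tcat.
under eq_bigr => T' _ do rewrite rmorphM /shuffle_transition rmorph_sum /= -scalerA scaler_suml.
rewrite -scaler_sumr exchange_big /= big_seq big1 ?scaler0 // => v vT.
have Tv := vertices_isvert vT; have [Pge0 Ppos] := Pv v vT.
have [pv|vp] := leqP p (size v); last first.
  rewrite big1 // => T' _.
  (* Below height [p] the weight is nonnegative but not positive. *)
  have -> : P T v = 0.
    apply/eqP; move: Pge0; rewrite Order.POrderTheory.le_eqVlt eq_sym => /orP[//|/Ppos].
    by rewrite leqNgt vp.
  by rewrite !mul0r rmorph0 scale0r.
set C := shuffle_class d.+1 p T v.
under eq_bigr => T' _.
  rewrite mulrAC rmorphM rmorph_nat -scalerA /= mulrb; over.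
rewrite -scaler_sumr (_ : \sum_(_ <- _) _ = 0) ?scaler0 //.
rewrite (eq_bigr (fun T' => if T' \in C then tree_poly d h T' i else 0)); last first.
  by move=> T' _; case: ifP => _; rewrite ?scale1r ?scale0r.
(* The class lies inside [s], so restricting the sum to trees of [C] yields the full class sum. *)
rewrite -big_mkcond -big_filter.
rewrite -[RHS](sum_shuffle_class_eq0 h_perm i TD Tv pv path_eq0); apply: perm_big.
apply: uniq_perm; rewrite ?filter_uniq ?undup_uniq ?trees_le_uniq // => T'.
rewrite mem_filter andb_idr // => T'C; rewrite sE.
exact: shuffle_class_catalan Tcat Tv pv T'C.
Qed.

End Chain.

(** * Nilpotency of the homogeneous Jacobian matrix *)

Section Nilpotency.
Variables (K : fieldType) (n d : nat) (h : 'I_n -> seq 'I_n -> K).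
Hypothesis h_perm : forall i w w', perm_eq w w' -> h i w = h i w'.
Hypothesis char0 : forall k, k.+1%:R != 0 :> K.
Hypothesis d_gt0 : (0 < d)%N.
Local Notation H := (fun i => sym_form d h i (nseq d.+1 (@genvec K n))).

(* The inverse of [1 - JH] has polynomial entries, and its part of degree [p * d] is [JH ^+ p]. *)
Lemma path_form_nilpotent :
  jinv (fun i => 'X_i - H i) ->
  exists2 p, (0 < p)%N & forall i j, path_form d h p i j (nseq (p * d) (@genvec K n)) = 0.
Proof.
move=> [A FA]; pose J := Jac H.
have JF : Jac (fun i => 'X_i - H i) = 1%:M - J.
  by apply/matrixP=> i j; rewrite !mxE mderivB mderivXU.
(* A finite geometric series with remainder, from [(1%:M - J) *m A = 1%:M]. *)
have AE q : A = \sum_(r < q) mxiter J r + mxiter J q *m A.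
  elim: q => [|q IHq]; first by rewrite big_ord0 add0r mul1mx.
  have iterC r : mxiter J r *m J = mxiter J r.+1.
    elim: r => [|r IHr]; first by rewrite /= mul1mx mulmx1.
    by rewrite [LHS]/= -mulmxA -/(mxiter J r) IHr.
  rewrite {1}IHq big_ord_recr /= -addrA; congr (_ + _).
  rewrite -/(mxiter J q) -[J *m _]/(mxiter J q.+1) -iterC -mulmxA.
  have -> : J *m A = A - 1%:M by rewrite -FA JF mulmxBl mul1mx opprB addrC subrK.
  by rewrite mulmxBr mulmx1 addrC subrK.
(* Entries of [A] have degree below [p], hence no part of degree [p * d]; the successor keeps [p]
   positive. *)
pose p := (\max_i \max_j msize (A i j)).+1.
have Ap i j : (msize (A i j) <= p)%N.
  apply: leqW; apply: leq_trans (@leq_bigmax _ (fun i => \max_j msize (A i j)) i).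
  exact: (@leq_bigmax _ (fun j => msize (A i j))).
exists p => // i j.
have scalE q : (d.+1%:R : {mpoly K[n]}) ^+ q = (d.+1%:R ^+ q)%:MP.
  by rewrite -mpolyC_nat -rmorphXn.
have Jhom q a b : mxiter J q a b \is (q * d).-homog.
  by rewrite (@mxiter_path _ _ d _ h_perm) mxE scalE mul_mpolyC; apply/rpredZ/path_form_homog.
have Jp0 : mxiter J p i j = 0.
  apply/mpolyP => mu; rewrite mcoeff0.
  have [mup|] := eqVneq (mdeg mu) (p * d)%N; last exact: (dhomog_nemf_coeff (Jhom p i j)).
  have : (A i j)@_mu = 0.
    apply/memN_msupp_eq0/msize_mdeg_ge; rewrite mup; apply: leq_trans (Ap i j) _.
    exact: leq_pmulr.
  (* Powers below [p] live in degrees below [p * d] and the remainder starts at [p.+1 * d], so only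
     [mxiter J p] meets the degree of [mu]. *)
  rewrite (AE p.+1) mxE mcoeffD summxE (raddf_sum (mcoeff mu)) big_ord_recr /=.
  rewrite big1 => [|r _]; last first.
    by apply: (dhomog_nemf_coeff (Jhom r i j)); rewrite /= mup eqn_pmul2r // gtn_eqF.
  rewrite add0r -/(mxiter J p) -/(mxiter J p.+1) => eq0.
  rewrite -[RHS]eq0 [X in _ + X](_ : _ = 0) ?addr0 //.
  rewrite mxE (raddf_sum (mcoeff mu)) big1 // => k _.
  have ordJA : ord_ge (p.+1 * d) (mxiter J p.+1 i k * A k j).
    rewrite -[X in ord_ge X _]addn0; apply: ord_geM => // nu nup.
    by apply: (dhomog_nemf_coeff (Jhom p.+1 i k)); rewrite /= ltn_eqF.
  by apply: ordJA; rewrite mup ltn_pmul2r.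
move/eqP: Jp0; rewrite (@mxiter_path _ _ d _ h_perm) mxE scalE mul_mpolyC scaler_eq0 expf_eq0.
by rewrite (negPf (char0 d)) andbF => /eqP.
Qed.

End Nilpotency.

(** * Complex Keller maps and the conclusion *)

Lemma keller_jinv n (F : 'I_n -> {mpoly Cplx[n]}) : keller_map F -> jinv F.
Proof.
move=> [c [c0 detF]]; exists ((c^-1)%:MP *: \adj (jacobian F)).
rewrite -scalemxAr (_ : Jac F = jacobian F) // mul_mx_adj detF scale_scalar_mx -mpolyCM.
by rewrite mulVf.
Qed.

Lemma aut_poly_automorphism n (F : 'I_n -> {mpoly Cplx[n]}) : aut F -> poly_automorphism F.
Proof. by move=> [G [FG GF]]; exists G; split=> i; rewrite comp_msubst. Qed.

Lemma Cplx_char0 k : k.+1%:R != 0 :> Cplx.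
Proof. exact: negbT (@Num.Theory.pnatr_eq0 Real[i] k.+1). Qed.

Theorem theorem1p6 :
  (exists d : nat, (3 <= d)%N /\
     forall p : nat, (1 <= p)%N ->
       exists k0 : nat, forall k : nat, (k0 <= k)%N ->
         exists P : ptree -> seq nat -> Real,
           shuffle_chain_family d p k P /\ uniform_stationary d p k P) ->
  jacobian_conjecture.
Proof.
(* The arity is [e.+3], which is also the degree imposed on [H]; the parameter [d] of the sections
   becomes [e.+2]. *)
move=> [[|[|[|e]]] [// _ chains]] n _ F /keller_jinv jF; apply: aut_poly_automorphism.
apply: (@jacobian_of_homogeneous _ e) jF => {F}n H Hhom.
pose h := sym_coef e.+2 H.
have h_perm i w w' : perm_eq w w' -> h i w = h i w' := @sym_coef_perm _ _ _ H i w w'.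
have HE i : 'X_i - sym_form e.+2 h i (nseq e.+3 (@genvec _ n)) = 'X_i - H i.
  by rewrite (sym_form_coef Cplx_char0).
move=> /(eq_jinv (fun i => esym (HE i))) jH; apply: (eq_aut HE).
(* The index [p] is extracted from [H] and only then passed to [chains]. *)
have [p p_gt0 path0] := path_form_nilpotent h_perm Cplx_char0 (isT : (0 < e.+2)%N) jH.
have [k0 chain] := chains p p_gt0.
apply: (@inverse_of_tree_sums _ _ e.+2 _ isT k0) => k i k0k.
have [P [Pchain Pstat]] := chain k k0k.
exact: (sum_catalans_eq0 (real_complex Real) h_perm path0 i Pchain Pstat).
Qed.
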